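(* Let $\phi:[0,\infty)\to\mathbb{R}$ and let $y_0\ge 0$ be a constant such that $\phi$ is square-integrable on $[0,y_0]$. Let $(\lambda_n)_{n\in\mathbb{N}}$ be a non-decreasing sequence of positive real numbers tending to infinity, let $(r_n)_{n\in\mathbb{N}}$ be a sequence of complex numbers, let $c\in\mathbb{R}$ and $X_0>0$. Assume that for all $y\ge y_0$ and all $X\ge X_0$, $$\phi(y)=c+\Re\Big(\sum_{\lambda_n\le X} r_n e^{i\lambda_n y}\Big)+\mathcal{E}(y,X),$$ where the function $\mathcal{E}(y,X)$ (defined by this identity) satisfies $$\lim_{Y\to\infty}\frac{1}{Y}\int_{y_0}^{Y}|\mathcal{E}(y,e^Y)|^2\,dy=0.$$ Let $\alpha,\beta>0$ and $\gamma\ge 0$, and assume either of the following: (a) $\beta>1/2$ and $\sum_{T<\lambda_n\le T+1}|r_n|\ll (\log T)^{\gamma}/T^{\beta}$ for $T>0$; (b) $\beta\le\min\{1,\alpha\}$, $\alpha^2+\alpha/2<\beta^2+\beta$, and $\sum_{S<\lambda_n\le T}|r_n|\ll (T-S)^{\alpha}(\log T)^{\gamma}/S^{\beta}$ for $T>S>0$. Then $\phi$ is a $B^2$-almost periodic function and therefore possesses a limiting distribution.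
   Context: Notation: $f\ll g$ means there is $M>0$ with $|f|\le M|g|$ for all sufficiently large values of the variable. A real function $\phi$ on $[0,\infty)$ (locally square-integrable) is $B^2$-almost periodic if for every $\epsilon>0$ there is a real-valued trigonometric polynomial $P(y)=\sum_{n=1}^{N}a_n e^{i\mu_n y}$ ($a_n\in\mathbb{C}$, $\mu_n\in\mathbb{R}$) with $\limsup_{Y\to\infty}\frac1Y\int_0^Y|\phi(y)-P(y)|^2dy<\epsilon^2$. A function $\vec\phi:[0,\infty)\to\mathbb{R}^\ell$ has a limiting distribution $\mu$ if $\mu$ is a probability measure on $\mathbb{R}^\ell$ and $\lim_{Y\to\infty}\frac1Y\int_0^Y f(\vec\phi(y))dy=\int_{\mathbb{R}^\ell}f\,d\mu$ for every bounded continuous $f:\mathbb{R}^\ell\to\mathbb{R}$. *)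

(* Defs.v *)
From HB Require Import structures.
From mathcomp Require Import all_boot all_order all_algebra.
From mathcomp Require Import all_classical all_reals all_analysis.
From mathcomp Require Import complex.
Set Implicit Arguments. Unset Strict Implicit. Unset Printing Implicit Defensive.
Import Order.TTheory GRing.Theory Num.Theory.
Import numFieldNormedType.Exports.
Local Open Scope classical_set_scope.
Local Open Scope ring_scope.

Section Defs.
Variable R : realType.

Definition expi (t : R) : R[i] := (cos t +i* sin t)%C.

(* Re( sum_{lambda_n <= X} r_n e^{i lambda_n y} ); the index set is finite
   since lambda_n -> +oo, and we use the finitely-supported big sum. *)
Definition trunc_sum (lam : nat -> R) (r : nat -> R[i]) (X y : R) : R :=
  complex.Re (\sum_(n \in [set n | lam n <= X]) (r n * expi (lam n * y))).

Definition abs_sum (lam : nat -> R) (r : nat -> R[i]) (S T : R) : R :=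
  \sum_(n \in [set n | S < lam n <= T]) Normc.normc (r n).

Definition trig_poly (N : nat) (a : nat -> R[i]) (mu : nat -> R) (y : R) : R[i] :=
  \sum_(1 <= n < N.+1) a n * expi (mu n * y).

Definition B2_almost_periodic (phi : R -> R) : Prop :=
  forall eps : R, 0 < eps ->
    exists (N : nat) (a : nat -> R[i]) (mu : nat -> R),
      (forall y, complex.Im (trig_poly N a mu y) = 0) /\
      (limf_esup (fun Y : R => (Y^-1)%:E *
          \int[lebesgue_measure]_(y in `[0%R, Y]) 
             ((phi y - complex.Re (trig_poly N a mu y)) ^+ 2)%:E)
        +oo%R < (eps ^+ 2)%:E)%E.

Definition has_limiting_distribution (phi : R -> R) : Prop :=
  exists mu : probability R R,
    forall f : R -> R, continuous f -> (exists M, forall x, `|f x| <= M) ->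
      ((Y^-1)%:E * \int[lebesgue_measure]_(y in `[0%R, Y]) (f (phi y))%:E)%E
        @[Y --> +oo%R] --> (\int[mu]_x (f x)%:E)%E.

End Defs.

(* Main.v *)
(** The mean square of a tail [sum_(k0 < lam n <= e^Y) r_n e^(i lam_n y)] over
    [[y0, Y]] is at most [sum_(m, n) |r_m r_n| min(Y, 2 / |lam_m - lam_n|) / Y].
    Grouping the frequencies into unit blocks, whose mass is [O(k^-b)] for the
    [k]-th one, and using [sum_(d <= e^Y) min(Y, 1/d) = O(Y)], this is
    [O(sum_(lam_n > k0) |r_n| lam_n^-b)], uniformly in [Y]. Summing by dyadic
    blocks, that series converges as soon as [sum_(2^j < lam_n <= 2^(j+1)) |r_n|
    = O(2^(j (a - b)))] with [a < 2 b]; hypothesis (a) gives this with [a = 1],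
    hypothesis (b) with [a = alpha], [b] being slightly smaller than [beta] in
    order to absorb the logarithms. Hence [phi] is [B^2]-almost periodic.

    If [phi] is [B^2]-almost periodic, then the means of [|phi - t|] converge for
    every real [t]: this reduces to trigonometric polynomials, for which [|P - t|]
    is a uniform limit of trigonometric polynomials. Differences of the functions
    [|. - t|] yield piecewise linear "ramps", whose limiting means determine a
    distribution function; its Lebesgue-Stieltjes measure is the limiting
    distribution, as bounded continuous functions are approximated by combinations
    of ramps. *)
Require Import Defs.
From HB Require Import structures.
From mathcomp Require Import all_boot all_order all_algebra.
From mathcomp Require Import all_classical all_reals all_analysis.
From mathcomp Require Import complex.
From mathcomp Require Import measurable_realfun zify ring lra.
Import Order.TTheory GRing.Theory Num.Theory.
Import numFieldNormedType.Exports.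
Local Open Scope classical_set_scope.
Local Open Scope ring_scope.

(** * Means of trigonometric polynomials *)

Section Cosine_integrals.
Context {R : realType}.
Notation leb := (@lebesgue_measure R).

Lemma continuous_cos_affine (m t : R) : continuous (fun y : R => cos (m * y + t)).
Proof.
move=> y; apply: (@continuous_comp _ _ _ (fun y => m * y + t) cos); last exact: continuous_cos.
by apply: cvgD; [apply: cvgM; [exact: cvg_cst|exact: cvg_id]|exact: cvg_cst].
Qed.

Lemma continuous_integrable_itv (f : R -> R) (a b : R) :
  continuous f -> leb.-integrable `[a, b] (EFin \o f).
Proof.
move=> cf; apply: continuous_compact_integrable; first exact: segment_compact.
exact: continuous_subspaceT.
Qed.

Lemma continuous_measurable_itv (f : R -> R) (D : set R) :
  measurable D -> continuous f -> measurable_fun (D : set (measurableTypeR R)) f.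
Proof. by move=> mD cf; apply: measurable_funTS; exact: continuous_measurable_fun. Qed.

Lemma Rintegral_cos_affine (m t a b : R) : m != 0 -> a < b ->
  \int[leb]_(y in `[a, b]) cos (m * y + t) =
  m^-1 * (sin (m * b + t) - sin (m * a + t)).
Proof.
move=> m0 ab; pose F y : R := m^-1 * sin (m * y + t).
have dF (x : R) : is_derive x 1 F (cos (m * x + t)).
  by rewrite /F; apply: is_derive_eq; rewrite !scaler1 addr0 /= /GRing.scale/=; field.
have cF : continuous F
  by move=> x; apply: differentiable_continuous; apply/derivable1_diffP; have [] := dF x.
rewrite /Rintegral (@continuous_FTC2 _ _ F)//.
- by rewrite /F /= mulrBr.
- by apply: continuous_subspaceT; exact: continuous_cos_affine.
- split.
  + by move=> x _; have [] := dF x.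
  + by apply: cvg_at_right_filter; exact: cF.
  + by apply: cvg_at_left_filter; exact: cF.
- by move=> x _; rewrite derive1E; have [_ ->] := dF x.
Qed.

Lemma Rintegral_cos_le (m t a b : R) : a <= b ->
  `|\int[leb]_(y in `[a, b]) cos (m * y + t)| <= b - a.
Proof.
move=> ab; have ci := continuous_integrable_itv _ a b (continuous_cos_affine m t).
apply: (le_trans (le_normr_Rintegral _ _)) => //.
have -> : b - a = \int[leb]_(y in `[a, b]) 1.
  by rewrite Rintegral_cst// mul1r/= lebesgue_measure_itv/= lte_fin; case: ltgtP ab => // ->; rewrite subrr.
apply: le_Rintegral => //.
- exact: (integrable_norm ci).
- by apply: continuous_integrable_itv => x; exact: cvg_cst.
- by move=> x _; exact: cos_max.
Qed.

Lemma Rintegral_cos_le_inv (m t a b : R) : m != 0 -> a <= b ->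
  `|\int[leb]_(y in `[a, b]) cos (m * y + t)| <= 2 / `|m|.
Proof.
move=> m0; rewrite le_eqVlt => /predU1P[->|ab].
  by rewrite set_itv1 Rintegral_set1 normr0 divr_ge0.
rewrite Rintegral_cos_affine// normrM normfV mulrC ler_pM2r ?invr_gt0 ?normr_gt0//.
by rewrite (le_trans (ler_normB _ _))// -[2]/(1 + 1) lerD// sin_max.
Qed.

End Cosine_integrals.

Section Real_integrability.
Context d (T : measurableType d) (R : realType) (mu : {measure set T -> \bar R}).

Lemma EFin_integrableD (D : set T) (u v : T -> R) : measurable D ->
  mu.-integrable D (EFin \o u) -> mu.-integrable D (EFin \o v) ->
  mu.-integrable D (EFin \o (fun y => u y + v y)).
Proof. by move=> mD iu iv; exact: (integrableD mD iu iv). Qed.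

Lemma EFin_integrableB (D : set T) (u v : T -> R) : measurable D ->
  mu.-integrable D (EFin \o u) -> mu.-integrable D (EFin \o v) ->
  mu.-integrable D (EFin \o (fun y => u y - v y)).
Proof. by move=> mD iu iv; exact: (integrableB mD iu iv). Qed.

Lemma EFin_integrableZ (D : set T) (a : R) (u : T -> R) : measurable D ->
  mu.-integrable D (EFin \o u) -> mu.-integrable D (EFin \o (fun y => a * u y)).
Proof. by move=> mD iu; exact: (integrableZl mD a iu). Qed.

End Real_integrability.

(** * Means over [[0, Y]] and convergence of means *)

Section Mean_values.
Context {R : realType}.
Notation leb := (@lebesgue_measure R).

Definition mean (u : R -> R) (Y : R) : R := Y^-1 * \int[leb]_(y in `[0, Y]) u y.

Lemma meanD (u v : R -> R) (Y : R) :
  leb.-integrable `[0, Y] (EFin \o u) -> leb.-integrable `[0, Y] (EFin \o v) ->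
  mean (fun y => u y + v y) Y = mean u Y + mean v Y.
Proof. by move=> iu iv; rewrite /mean RintegralD// mulrDr. Qed.

Lemma meanZ (a : R) (u : R -> R) (Y : R) :
  leb.-integrable `[0, Y] (EFin \o u) ->
  mean (fun y => a * u y) Y = a * mean u Y.
Proof. by move=> iu; rewrite /mean RintegralZl// mulrCA. Qed.

Lemma mean_cst (a Y : R) : 0 < Y -> mean (fun=> a) Y = a.
Proof.
move=> Y0; rewrite /mean Rintegral_cst//= lebesgue_measure_itv/= lte_fin Y0/= subr0.
by rewrite mulrCA mulVf ?mulr1// gt_eqF.
Qed.

Lemma le_mean (u v : R -> R) (Y : R) : 0 < Y ->
  leb.-integrable `[0, Y] (EFin \o u) -> leb.-integrable `[0, Y] (EFin \o v) ->
  (forall y, u y <= v y) -> mean u Y <= mean v Y.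
Proof.
move=> Y0 iu iv uv; apply: ler_wpM2l; first by rewrite invr_ge0 ltW.
by apply: le_Rintegral => // y _.
Qed.

(** Comparing [u] with [v + w] and [v] with [u + w] avoids integrating [|u - v|] itself. *)
Lemma mean_dist_le (u v w : R -> R) (Y : R) : 0 < Y ->
  leb.-integrable `[0, Y] (EFin \o u) -> leb.-integrable `[0, Y] (EFin \o v) ->
  leb.-integrable `[0, Y] (EFin \o w) ->
  (forall y, `|u y - v y| <= w y) -> `|mean u Y - mean v Y| <= mean w Y.
Proof.
move=> Y0 iu iv iw uv.
have ivw : leb.-integrable `[0, Y] (EFin \o (fun y => v y + w y)) by exact: EFin_integrableD.
have iuw : leb.-integrable `[0, Y] (EFin \o (fun y => u y + w y)) by exact: EFin_integrableD.
have vw : mean (fun y => v y + w y) Y = mean v Y + mean w Y by exact: meanD.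
have uw : mean (fun y => u y + w y) Y = mean u Y + mean w Y by exact: meanD.
have h y : u y <= v y + w y by move: (uv y); rewrite ler_norml => /andP[_]; lra.
have h' y : v y <= u y + w y by move: (uv y); rewrite ler_norml => /andP[+ _]; lra.
have := le_mean u (fun y => v y + w y) Y Y0 iu ivw h.
have := le_mean v (fun y => u y + w y) Y Y0 iv iuw h'.
rewrite vw uw // => h1 h2; rewrite ler_norml; apply/andP; split.
  by move: h1; lra.
by move: h2; lra.
Qed.

(** Cauchy criterion. The approximant may change with [eps], so convergence of means passes from
    trigonometric polynomials to whatever they approximate in mean. *)
Lemma cvg_near_approx (f : R -> R) :
  (forall eps : R, 0 < eps -> exists2 u : R -> R, cvg (u Y @[Y --> +oo]) &
     \forall Y \near +oo, `|f Y - u Y| <= eps) ->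
  cvg (f Y @[Y --> +oo]).
Proof.
move=> fu; apply/cauchy_cvgP/cauchy_exP => e e0.
have e2 : 0 < e / 2 by rewrite divr_gt0.
have e4 : 0 < e / 4 by rewrite divr_gt0.
have [u ul uf] := fu _ e4.
exists (lim (u Y @[Y --> +oo])); rewrite /= /nbhs/=.
have : \forall Y \near +oo, `|lim (u Y @[Y --> +oo]) - u Y| < e / 4.
  by move/cvgrPdist_lt : ul; apply.
move=> h; near=> Y; rewrite /ball/=.
have h1 : `|f Y - u Y| <= e / 4 by near: Y.
have h2 : `|lim (u Y @[Y --> +oo]) - u Y| < e / 4 by near: Y.
rewrite -(subrKA (u Y)) (le_lt_trans (ler_normD _ _))// [X in _ + X]distrC.
lra.
Unshelve. all: end_near. Qed.

End Mean_values.

(** * Real trigonometric polynomials and their absolute values *)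

Section Trigonometric_functions.
Context {R : realType}.
Notation leb := (@lebesgue_measure R).

(** Real trigonometric polynomials in phase form: a shifted cosine replaces a conjugate pair of
    exponentials, which keeps the coefficients real and lets closure properties go by induction. *)
Inductive trigp : (R -> R) -> Prop :=
| trigp_cos a m t : trigp (fun y => a * cos (m * y + t))
| trigpD f g : trigp f -> trigp g -> trigp (fun y => f y + g y).

Lemma trigp_cst (a : R) : trigp (fun=> a).
Proof.
rewrite (_ : (fun=> a) = (fun y => a * cos (0 * y + 0))); first exact: trigp_cos.
by apply/funext => y; rewrite mul0r addr0 cos0 mulr1.
Qed.

Lemma trigpZ (a : R) f : trigp f -> trigp (fun y => a * f y).
Proof.
elim=> [b m t|g h _ ig _ ih].
  rewrite (_ : (fun _ => _) = (fun y => (a * b) * cos (m * y + t))); first exact: trigp_cos.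
  by apply/funext => y; rewrite mulrA.
rewrite (_ : (fun _ => _) = (fun y => a * g y + a * h y)); first exact: trigpD.
by apply/funext => y; rewrite mulrDr.
Qed.

(** Product-to-sum formula on each pair of cosines. Closure under products makes every polynomial in
    [f] a trigonometric polynomial, as the approximation of [|f|] requires. *)
Lemma trigpM f g : trigp f -> trigp g -> trigp (fun y => f y * g y).
Proof.
move=> tf tg; elim: tf => [a m t|f1 f2 _ i1 _ i2]; last first.
  rewrite (_ : (fun _ => _) = (fun y => f1 y * g y + f2 y * g y)); first exact: trigpD.
  by apply/funext => y; rewrite mulrDl.
elim: tg => [b n s|g1 g2 _ i1 _ i2]; last first.
  rewrite (_ : (fun _ => _) = (fun y => a * cos (m * y + t) * g1 y + a * cos (m * y + t) * g2 y)).
    exact: trigpD.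
  by apply/funext => y; rewrite mulrDr.
rewrite (_ : (fun _ => _) = (fun y => (a * b / 2) * cos ((m + n) * y + (t + s)) +
   (a * b / 2) * cos ((m - n) * y + (t - s)))); first by apply: trigpD; exact: trigp_cos.
apply/funext => y.
rewrite (_ : (m + n) * y + (t + s) = (m * y + t) + (n * y + s)); last by ring.
rewrite (_ : (m - n) * y + (t - s) = (m * y + t) - (n * y + s)); last by ring.
by move: (m * y + t) (n * y + s) => u v; rewrite cosD cosB; field.
Qed.

Lemma trigp_continuous f : trigp f -> continuous f.
Proof.
elim=> [a m t|g h _ ig _ ih] x.
  by apply: cvgM; [exact: cvg_cst|exact: continuous_cos_affine].
by apply: cvgD; [exact: ig|exact: ih].
Qed.

(** The bound is strictly positive so that [f / M] makes sense and takes values in [-1, 1]. *)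
Lemma trigp_bounded f : trigp f -> exists2 M, 0 < M & forall y, `|f y| <= M.
Proof.
elim=> [a m t|g h _ [M M0 gM] _ [N N0 hN]].
  exists (1 + `|a|) => [|y]; first by rewrite ltr_pwDl.
  rewrite normrM; have := cos_max (m * y + t); have := normr_ge0 a.
  by move: `|a| `|cos _| => u v; nra.
exists (M + N) => [|y]; first exact: addr_gt0.
by rewrite (le_trans (ler_normD _ _))// lerD.
Qed.

Lemma trigp_integrable f (a b : R) : trigp f -> leb.-integrable `[a, b] (EFin \o f).
Proof. by move=> /trigp_continuous; exact: continuous_integrable_itv. Qed.

(** At a nonzero frequency the integral stays below [2 / |m|], so the mean tends to 0; at frequency
    0 it is the constant [cos t]. *)
Lemma cvg_mean_cos (m t : R) : cvg (mean (fun y => cos (m * y + t)) Y @[Y --> +oo]).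
Proof.
have [->|m0] := eqVneq m 0.
  apply: (@cvgP _ _ (cos t)); apply/cvgrPdist_le => e e0; near=> Y.
  rewrite (_ : (fun _ => _) = (fun=> cos t)); last by apply/funext => y; rewrite mul0r add0r.
  by rewrite mean_cst ?subrr ?normr0 ?ltW//; near: Y; exact: nbhs_pinfty_gt.
apply: (@cvgP _ _ 0); apply/cvgrPdist_le => e e0; near=> Y.
have Y0 : 0 < Y by near: Y; exact: nbhs_pinfty_gt.
rewrite sub0r normrN /mean normrM gtr0_norm ?invr_gt0// ler_pdivrMl//.
rewrite (le_trans (Rintegral_cos_le_inv _ _ _ _ m0 (ltW Y0)))//.
by rewrite -ler_pdivrMr//; near: Y; apply: nbhs_pinfty_ge; exact: num_real.
Unshelve. all: end_near. Qed.

Lemma trigp_cvg_mean f : trigp f -> cvg (mean f Y @[Y --> +oo]).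
Proof.
elim=> [a m t|g h tg ig th ih].
  rewrite (_ : (fun Y => _) = (fun Y => a * mean (fun y => cos (m * y + t)) Y)).
    by apply: is_cvgM; [exact: is_cvg_cst|exact: cvg_mean_cos].
  apply/funext => Y; rewrite meanZ//.
  by apply: continuous_integrable_itv; exact: continuous_cos_affine.
rewrite (_ : (fun Y => _) = (fun Y => mean g Y + mean h Y)); first exact: is_cvgD.
by apply/funext => Y; rewrite meanD//; exact: trigp_integrable.
Qed.

(** With [u = |x|] and [v = s x k], the error [d = u - v] is multiplied by [1 - (u + v) / 2], which
    is at most [1 - d / 2]; this recursion forces [d <= 2 / (k + 2)]. *)
Lemma abs_iteration_bound (s : R -> nat -> R) (x : R) :
  `|x| <= 1 -> s x 0%N = 0 ->
  (forall k, s x k.+1 = s x k + (x ^+ 2 - s x k ^+ 2) / 2) ->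
  forall k, 0 <= s x k <= `|x| /\ (`|x| - s x k) * k.+2%:R <= 2.
Proof.
move=> x1 s0 sS; elim=> [|k [/andP[sk0 skx] sk]].
  by rewrite s0 lexx normr_ge0 subr0; split=> //; have := normr_ge0 x; lra.
rewrite sS -(real_normK (num_real x)).
set u := `|x| in x1 skx sk *; set v := s x k in sk0 skx sk *.
have n2 : 2 <= k.+2%:R :> R by rewrite ler_nat.
rewrite -(natr1 k.+2); move: (k.+2%:R) n2 sk => n n2 sk.
have vs : 0 <= v + (u ^+ 2 - v ^+ 2) / 2 <= u.
  by apply/andP; split; nra.
split=> //.
have d0 : 0 <= u - v by lra.
have d1 : u - v <= 1 by lra.
have h1 : u - (v + (u ^+ 2 - v ^+ 2) / 2) <= (u - v) * (1 - (u - v) / 2) by nra.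
apply: (@le_trans _ _ ((u - v) * (1 - (u - v) / 2) * (n + 1))); first by rewrite ler_wpM2r//; lra.
move: (u - v) d0 d1 sk => d d0 d1 sk.
(* If [d (n + 1) <= 2], the factor [1 - d / 2 <= 1] suffices. Otherwise [d > 2 / (n + 1)] gives
   [(1 - d / 2) (n + 1) < n], and the induction hypothesis [d n <= 2] concludes. *)
have [dn|dn] := leP (d * (n + 1)) 2; first by nra.
nra.
Qed.

(* The polynomials q_0 = 0, q_(k+1) = q_k + (x^2 - q_k^2) / 2 converge to |x|
   uniformly on [-1, 1]. *)
Lemma trigp_norm_approx f (eps : R) : trigp f -> 0 < eps ->
  exists2 g, trigp g & forall y, `| `|f y| - g y| <= eps.
Proof.
move=> tf e0; have [M M0 fM] := trigp_bounded _ tf.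
pose q := fix q (x : R) k : R := if k is k'.+1 then q x k' + (x ^+ 2 - q x k' ^+ 2) / 2 else 0.
have tq k : trigp (fun y => q (M^-1 * f y) k).
  elim: k => [|k ih] /=; first exact: trigp_cst.
  have tsq g : trigp g -> trigp (fun y => g y ^+ 2) by move=> tg; exact: trigpM.
  apply: trigpD => //.
  rewrite (_ : (fun _ => _) = (fun y => 2^-1 * ((M^-1 * f y) ^+ 2 + (-1) * (q (M^-1 * f y) k ^+ 2)))).
    apply: trigpZ; apply: trigpD; first by apply: tsq; exact: trigpZ.
    by apply: trigpZ; exact: tsq.
  by apply/funext => y; rewrite mulrC mulN1r.
(* After scaling back by [M], the error of the k-th iterate is at most [2 M / (k + 2)]. *)
have [k hk] : exists k : nat, M * 2 / eps <= k.+2%:R.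
  exists (Num.bound (M * 2 / eps)).
  have /archi_boundP/ltW/le_trans : 0 <= M * 2 / eps by rewrite divr_ge0 ?mulr_ge0 ?ltW.
  by apply; rewrite ler_nat; exact/leqW/leqW.
exists (fun y => M * q (M^-1 * f y) k); first exact/trigpZ/tq.
move=> y; have fy1 : `|M^-1 * f y| <= 1.
  by rewrite normrM gtr0_norm ?invr_gt0// ler_pdivrMl// mulr1.
have [/andP[q0 q1] q2] := abs_iteration_bound q _ fy1 erefl (fun=> erefl) k.
have -> : `|f y| = M * `|M^-1 * f y|.
  by rewrite normrM gtr0_norm ?invr_gt0// mulrA mulfV ?mul1r ?gt_eqF.
rewrite -mulrBr normrM (gtr0_norm M0) ger0_norm ?subr_ge0//.
have k0 : 0 < k.+2%:R :> R by [].
rewrite -(ler_pM2r k0) -mulrA (@le_trans _ _ (M * 2))//; first by rewrite ler_pM2l.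
by rewrite -ler_pdivrMl// mulrC.
Qed.

Lemma trigp_cvg_mean_dist f (b : R) : trigp f ->
  cvg (mean (fun y => `|f y - b|) Y @[Y --> +oo]).
Proof.
move=> tf; have tfb : trigp (fun y => f y - b) by apply: trigpD => //; exact: trigp_cst.
apply: cvg_near_approx => e e0.
have [g tg fg] := trigp_norm_approx _ _ tfb e0.
exists (mean g); first exact: trigp_cvg_mean.
near=> Y; have Y0 : 0 < Y by near: Y; exact: nbhs_pinfty_gt.
rewrite -[leRHS](mean_cst e Y)//; apply: mean_dist_le => //.
- by apply: continuous_integrable_itv => x; apply: cvg_norm; exact: (trigp_continuous _ tfb).
- exact: trigp_integrable.
- by apply: continuous_integrable_itv => x; exact: cvg_cst.
Unshelve. all: end_near. Qed.

End Trigonometric_functions.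

(** * Means of almost periodic functions *)

Section B2_approximation.
Context {R : realType}.
Notation leb := (@lebesgue_measure R).

Lemma trigp_Re_expi (z : R[i]) (m : R) : trigp (fun y => complex.Re (z * expi (m * y))).
Proof.
(* The real part is [a cos x - b sin x], and [- sin x = cos (x + pi / 2)]. *)
case: z => a b; rewrite (_ : (fun _ => _) = (fun y => a * cos (m * y + 0) + b * cos (m * y + pi / 2))).
  by apply: trigpD; exact: trigp_cos.
by apply/funext => y /=; rewrite addr0 cosDpihalf mulrN.
Qed.

Lemma ReD (z w : R[i]) : complex.Re (z + w) = complex.Re z + complex.Re w.
Proof. by case: z w => a b [c d]. Qed.

Lemma Re_sum (I : Type) (s : seq I) (p : pred I) (F : I -> R[i]) :
  complex.Re (\sum_(i <- s | p i) F i) = \sum_(i <- s | p i) complex.Re (F i).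
Proof. by apply: (big_morph (fun z : R[i] => complex.Re z)) => //; exact: ReD. Qed.

Lemma trigp_sum (I : Type) (s : seq I) (p : pred I) (F : I -> R -> R) :
  (forall i, trigp (F i)) -> trigp (fun y => \sum_(i <- s | p i) F i y).
Proof.
move=> tF; elim: s => [|i s ih].
  rewrite (_ : (fun _ => _) = (fun=> 0)); first exact: trigp_cst.
  by apply/funext => y; rewrite big_nil.
rewrite (_ : (fun _ => _) =
  (fun y => (if p i then F i y else 0) + \sum_(i <- s | p i) F i y)).
  by apply: trigpD => //; case: (p i); [exact: tF|exact: trigp_cst].
by apply/funext => y; rewrite big_cons; case: ifP => // _; rewrite add0r.
Qed.

Lemma trigp_Re_trig_poly N (a : nat -> R[i]) (mu : nat -> R) :
  trigp (fun y => complex.Re (trig_poly N a mu y)).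
Proof.
rewrite (_ : (fun _ => _) =
  (fun y => \sum_(1 <= n < N.+1) complex.Re (a n * expi (mu n * y)))).
  by apply: trigp_sum => n; exact: trigp_Re_expi.
by apply/funext => y; rewrite /trig_poly Re_sum.
Qed.

Lemma limf_esup_lt_near (f : R -> \bar R) (x : \bar R) :
  (limf_esup f +oo%R < x)%E -> \forall Y \near +oo, (f Y < x)%E.
Proof.
rewrite limf_esupE => /ereal_inf_lt[_ [V FV <-]] fx; apply: filterS FV => Y VY.
by apply: le_lt_trans fx; apply: ereal_sup_ubound; exists Y.
Qed.

Lemma limf_esup_le (f : R -> \bar R) (x : \bar R) :
  (\forall Y \near +oo, (f Y <= x)%E) -> (limf_esup f +oo%R <= x)%E.
Proof.
move=> fx; rewrite limf_esupE.
apply: (@le_trans _ _ (ereal_sup (f @` [set Y | (f Y <= x)%E]))).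
  by apply: ereal_inf_lbound; exists [set Y | (f Y <= x)%E].
by apply: ge_ereal_sup => _ [Y /= fY <-].
Qed.

Lemma B2_trigp (phi : R -> R) : B2_almost_periodic phi ->
  forall eps : R, 0 < eps -> exists2 P, trigp P & \forall Y \near +oo,
    (\int[leb]_(y in `[0%R, Y]) ((phi y - P y) ^+ 2)%:E <= (Y * eps ^+ 2)%:E)%E.
Proof.
move=> B2 e e0; have [N [a [mu [_ h]]]] := B2 _ e0.
exists (fun y => complex.Re (trig_poly N a mu y)); first exact: trigp_Re_trig_poly.
have {}h := limf_esup_lt_near _ _ h.
apply: filterS2 (nbhs_pinfty_gt (num_real 0)) h => Y Y0 /ltW.
by rewrite lee_pdivrMl// EFinM.
Qed.

Lemma measurable_fun_itv_bnd (phi : R -> R) (a b : R) : 0 <= a ->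
  measurable_fun (`[0%R, +oo[ : set R) phi ->
  measurable_fun (`[a, b] : set (measurableTypeR R)) phi.
Proof.
move=> a0; apply: measurable_funS => //.
by apply: subset_itv; rewrite bnd_simp.
Qed.

Lemma integrable_dominated (D : set (measurableTypeR R)) (u v : R -> R) : measurable D ->
  measurable_fun D u -> leb.-integrable D (EFin \o v) ->
  (forall y, D y -> `|u y| <= v y) -> leb.-integrable D (EFin \o u).
Proof.
move=> mD mu iv uv; apply: (le_integrable mD _ _ iv); first exact/measurable_EFinP.
move=> y Dy /=; rewrite lee_fin (le_trans (uv _ Dy))// ler_norm //.
Qed.

Lemma integrable_sqr_lty (u : R -> R) (D : set (measurableTypeR R)) : measurable D ->
  measurable_fun D u -> (\int[leb]_(y in D) (u y ^+ 2)%:E < +oo)%E ->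
  leb.-integrable D (EFin \o (fun y => u y ^+ 2)).
Proof.
move=> mD mu iu; apply/integrableP; split.
  by apply/measurable_EFinP; exact: measurable_funX.
by under eq_integral do rewrite /= ger0_norm ?sqr_ge0//.
Qed.

Lemma B2_trigp_integrable (phi : R -> R) :
  measurable_fun (`[0%R, +oo[ : set R) phi -> B2_almost_periodic phi ->
  forall eps : R, 0 < eps -> exists2 P, trigp P & \forall Y \near +oo,
    [/\ leb.-integrable `[0%R, Y] (EFin \o phi),
     leb.-integrable `[0%R, Y] (EFin \o (fun y => (phi y - P y) ^+ 2)) &
     mean (fun y => (phi y - P y) ^+ 2) Y <= eps ^+ 2].
Proof.
move=> mphi B2 e e0; have [P tP hP] := B2_trigp _ B2 _ e0; exists P => //.
near=> Y; have Y0 : 0 < Y by near: Y; exact: nbhs_pinfty_gt.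
have m1 : measurable_fun (`[0%R, Y] : set (measurableTypeR R)) phi.
  exact: measurable_fun_itv_bnd mphi.
have hY : (\int[leb]_(y in `[0%R, Y]) ((phi y - P y) ^+ 2)%:E <= (Y * e ^+ 2)%:E)%E.
  by near: Y.
have m2 : measurable_fun (`[0%R, Y] : set (measurableTypeR R)) (fun y => phi y - P y).
  apply: measurable_funB => //; apply: continuous_measurable_itv => //.
  exact: trigp_continuous.
have i2 : leb.-integrable `[0%R, Y] (EFin \o (fun y => (phi y - P y) ^+ 2)).
  by apply: integrable_sqr_lty => //; rewrite (le_lt_trans hY)// ltry.
split=> //.
  have iP : leb.-integrable `[0%R, Y] (EFin \o (fun y => `|P y| + 1)).
    apply: continuous_integrable_itv => y; apply: cvgD; last exact: cvg_cst.
    by apply: cvg_norm; exact: (trigp_continuous _ tP).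
  (* Domination by [|z| <= 1 + z^2] at [z = phi y - P y]. *)
  apply: (integrable_dominated _ _ (fun y => (`|P y| + 1) + (phi y - P y) ^+ 2)) => //.
    exact: EFin_integrableD.
  move=> y _; rewrite -[X in `|X|](subrK (P y)) (le_trans (ler_normD _ _))// addrC -addrA lerD2l.
  by move: (phi y - P y) => z; rewrite -(real_normK (num_real z)); move: `|z| (normr_ge0 z) => u; nra.
rewrite /mean ler_pdivrMl// -lee_fin (le_trans _ hY)//.
rewrite /Rintegral fineK//; exact: integrable_fin_num.
Unshelve. all: end_near. Qed.

(** Approximation with error 1 gives integrability on [[0, Y']] for some [Y' >= Y], which then
    restricts to [[0, Y]]. *)
Lemma B2_integrable (phi : R -> R) (Y : R) :
  measurable_fun (`[0%R, +oo[ : set R) phi -> B2_almost_periodic phi ->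
  leb.-integrable `[0, Y] (EFin \o phi).
Proof.
move=> mphi B2; have [P _ h] := B2_trigp_integrable _ mphi B2 _ ltr01.
have [Y' [YY' [iY' _ _]]] : exists Y', Y <= Y' /\ [/\ leb.-integrable `[0%R, Y'] (EFin \o phi),
     leb.-integrable `[0%R, Y'] (EFin \o (fun y => (phi y - P y) ^+ 2)) &
     mean (fun y => (phi y - P y) ^+ 2) Y' <= 1 ^+ 2].
  near (+oo : set_system R) => Y'; exists Y'; split; near: Y' => //.
  by apply: nbhs_pinfty_ge; exact: num_real.
apply: integrableS iY' => //; apply: subset_itv; rewrite bnd_simp//.
Unshelve. all: end_near. Qed.

Lemma B2_cvg_mean_dist (phi : R -> R) (b : R) :
  measurable_fun (`[0%R, +oo[ : set R) phi -> B2_almost_periodic phi ->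
  cvg (mean (fun y => `|phi y - b|) Y @[Y --> +oo]).
Proof.
move=> mphi B2; apply: cvg_near_approx => e e0.
have [P tP hP] := B2_trigp_integrable _ mphi B2 _ e0.
exists (mean (fun y => `|P y - b|)); first exact: trigp_cvg_mean_dist.
near=> Y; have Y0 : 0 < Y by near: Y; exact: nbhs_pinfty_gt.
have [i1 i2 mle] : [/\ leb.-integrable `[0%R, Y] (EFin \o phi),
     leb.-integrable `[0%R, Y] (EFin \o (fun y => (phi y - P y) ^+ 2)) &
     mean (fun y => (phi y - P y) ^+ 2) Y <= e ^+ 2] by near: Y.
have ic (d : R) : leb.-integrable `[0, Y] (EFin \o (fun=> d)).
  by apply: continuous_integrable_itv => x; exact: cvg_cst.
have iw : leb.-integrable `[0, Y] (EFin \o (fun y => (2 * e)^-1 * (phi y - P y) ^+ 2)).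
  exact: EFin_integrableZ.
have ib : leb.-integrable `[0, Y] (EFin \o (fun y => phi y - b)) by exact: EFin_integrableB.
(* AM-GM: |z| <= z^2 / (2 e) + e / 2 *)
apply: (@le_trans _ _ (mean (fun y => (2 * e)^-1 * (phi y - P y) ^+ 2 + e / 2) Y)).
  apply: mean_dist_le => //.
  - exact: (integrable_norm ib).
  - apply: continuous_integrable_itv => x; apply: cvg_norm.
    by apply: cvgB; [exact: (trigp_continuous _ tP)|exact: cvg_cst].
  - exact: EFin_integrableD.
  - move=> y; rewrite (le_trans (ler_dist_dist _ _))//.
    rewrite (_ : phi y - b - (P y - b) = phi y - P y); last by ring.
    rewrite -(real_normK (num_real (phi y - P y))); move: `|phi y - P y| => z.
    have : 0 <= (2 * e)^-1 * (z - e) ^+ 2 by rewrite mulr_ge0 ?sqr_ge0// invr_ge0 mulr_ge0 ?ltW.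
    rewrite (_ : (2 * e)^-1 * (z - e) ^+ 2 = (2 * e)^-1 * z ^+ 2 + e / 2 - z); first lra.
    by field; rewrite gt_eqF.
rewrite meanD// mean_cst// (_ : mean _ Y = (2 * e)^-1 * mean (fun y => (phi y - P y) ^+ 2) Y);
  last exact: meanZ.
have : (2 * e)^-1 * mean (fun y => (phi y - P y) ^+ 2) Y <= (2 * e)^-1 * e ^+ 2.
  by rewrite ler_wpM2l// invr_ge0 mulr_ge0 ?ltW.
rewrite (_ : (2 * e)^-1 * e ^+ 2 = e / 2); last by field; rewrite gt_eqF.
by move: (_ * mean _ Y) => z; lra.
Unshelve. all: end_near. Qed.

End B2_approximation.

(** * Limiting distributions *)

Section Limiting_distribution.
Context {R : realType}.

(** The measure is the Lebesgue-Stieltjes measure of [F], pushed forward along the identity to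
    become a [probability R R]. *)
Lemma probability_of_cdf (F : R -> R) :
  {homo F : x y / x <= y} -> right_continuous F -> F @ -oo --> (0 : R) ->
  F @ +oo --> (1 : R) ->
  exists mu : probability R R, forall x, mu `]-oo, x]%classic = (F x)%:E.
Proof.
move=> Fnd Frc F0 F1.
pose C := isCumulative.Build R _ R F Fnd Frc.
pose B := isCumulativeBounded.Build R 0 1 F F0 F1.
pose G : cumulativeBounded (0 : R) (1 : R) := HB.pack F C B.
pose idR : measurableTypeR R -> R := idfun.
pose M := isMeasurableFun.Build _ _ (measurableTypeR R) R idR (@measurable_id _ _ setT).
pose X : {mfun measurableTypeR R >-> R} := HB.pack idR M.
exists (distribution (lebesgue_stieltjes_measure G) X).
exact: (cdf_lebesgue_stieltjes_id G).
Qed.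

(* 1 on ]-oo, a], 0 on [b, +oo[, affine in between. *)
Definition ramp (a b t : R) : R := (`|t - b| - `|t - a| + (b - a)) / (2 * (b - a)).

Lemma ramp_le a b t : a < b -> t <= a -> ramp a b t = 1.
Proof.
move=> ab ta; rewrite /ramp !ler0_norm ?subr_le0// ?(le_trans ta (ltW ab))//.
by field; rewrite gt_eqF// subr_gt0.
Qed.

Lemma ramp_ge a b t : a < b -> b <= t -> ramp a b t = 0.
Proof.
move=> ab bt; rewrite /ramp !ger0_norm ?subr_ge0// ?(le_trans (ltW ab) bt)//.
by field; rewrite gt_eqF// subr_gt0.
Qed.

Lemma ramp_ge0_le1 a b t : a < b -> 0 <= ramp a b t <= 1.
Proof.
move=> ab; rewrite /ramp.
have b0 : 0 < 2 * (b - a) by rewrite mulr_gt0// subr_gt0.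
rewrite divr_ge0 ?(ltW b0)//= ?ler_pdivrMr// ?mul1r.
  have := ler_dist_dist (t - b) (t - a).
  rewrite (_ : t - b - (t - a) = - (b - a)); last by ring.
  rewrite normrN (gtr0_norm (x := b - a)) ?subr_gt0// ler_norml => /andP[_]; lra.
have := ler_dist_dist (t - b) (t - a).
rewrite (_ : t - b - (t - a) = - (b - a)); last by ring.
rewrite normrN (gtr0_norm (x := b - a)) ?subr_gt0// ler_norml => /andP[+ _]; lra.
Qed.

Lemma continuous_ramp a b : continuous (ramp a b).
Proof.
move=> t; apply: cvgM; last exact: cvg_cst.
apply: cvgD; last exact: cvg_cst.
by apply: cvgB; apply: cvg_norm; apply: cvgB; (exact: cvg_id || exact: cvg_cst).
Qed.

(* Subdividing [a, b] makes the right-hand side telescope to a bounded sum. *)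
Lemma subdivision_constant (U F : R -> R) :
  (forall x, 0 <= F x <= 1) ->
  (forall a b, a < b -> `|U b - U a| <= (b - a) * (F b - F (a - (b - a)))) ->
  forall a b, a < b -> U a = U b.
Proof.
move=> F01 UF a b ab; apply/esym/eqP; rewrite -subr_eq0 -normr_le0.
apply/ler_addgt0Pl => e e0; rewrite addr0.
have [n n0 hn] : exists2 n : nat, (0 < n)%N & 2 * (b - a) / e <= n%:R.
  exists (Num.bound (2 * (b - a) / e)).+1 => //.
  have /archi_boundP/ltW/le_trans : 0 <= 2 * (b - a) / e.
    by rewrite divr_ge0 ?mulr_ge0 ?subr_ge0 ?ltW.
  by apply; rewrite ler_nat.
pose h := (b - a) / n%:R.
have n0R : 0 < n%:R :> R by rewrite ltr0n.
have h0 : 0 < h by rewrite divr_gt0// subr_gt0.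
have step k : `|U (a + k.+1%:R * h) - U (a + k%:R * h)| <=
    h * (F (a + k.+1%:R * h) - F (a + (k%:R - 1) * h)).
  have := UF (a + k%:R * h) (a + k.+1%:R * h).
  rewrite ltrD2l ltr_pM2r// ltr_nat => /(_ (ltnSn k)).
  rewrite (_ : a + k.+1%:R * h - (a + k%:R * h) = h); last by rewrite -natr1; ring.
  by rewrite (_ : a + k%:R * h - h = a + (k%:R - 1) * h)//; ring.
(* Each increment bound spans two subdivision steps of [F], so telescoping leaves two values of [F]
   at each end, in total at most 2. *)
have tot m : `|U (a + m%:R * h) - U a| <=
    h * (F (a + m%:R * h) + F (a + (m%:R - 1) * h) - F a - F (a - h)).
  elim: m => [|m ih].
    rewrite !mul0r addr0 subrr normr0 sub0r mulN1r.
    by rewrite (_ : _ - _ = 0) ?mulr0//; ring.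
  rewrite -(subrKA (U (a + m%:R * h))) (le_trans (ler_normD _ _))//.
  apply: (le_trans (lerD (step m) ih)); rewrite -mulrDr ler_pM2l//.
  rewrite (_ : m.+1%:R - 1 = m%:R :> R); last by rewrite -natr1; ring.
  lra.
have := tot n; rewrite (_ : a + n%:R * h = b); last first.
  by rewrite /h; field; rewrite gt_eqF.
move=> /le_trans; apply; apply: (@le_trans _ _ (h * 2)).
  rewrite ler_pM2l//.
  have := F01 b; have := F01 (a + (n%:R - 1) * h); have := F01 a; have := F01 (a - h).
  lra.
rewrite /h mulrAC ler_pdivrMr// [leLHS]mulrC.
by move: hn; rewrite ler_pdivrMr// [X in _ <= X]mulrC.
Qed.

End Limiting_distribution.

Section Bounded_integrals.
Context {R : realType}.

Lemma probability_integrable_bounded (mu : probability R R) (f : R -> R) (M : R) :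
  continuous f -> (forall x, `|f x| <= M) -> mu.-integrable setT (EFin \o f).
Proof.
move=> cf fM; apply: measurable_bounded_integrable => //.
- by rewrite (le_lt_trans (probability_le1 _ _))// ltry.
- exact: continuous_measurable_fun.
- exists M; split=> [|x Mx y _]; first exact: num_real.
  by rewrite /= (le_trans (fM y))// ltW.
Qed.

Lemma probability_Rintegral_cst (mu : probability R R) (a : R) :
  \int[mu]_x a = a.
Proof.
rewrite Rintegral_cst// -[RHS]mulr1; congr (_ * _).
exact: (congr1 fine (probability_setT mu)).
Qed.

Lemma ramp_bounded (a b : R) : a < b -> forall t, `|ramp a b t| <= 1.
Proof.
by move=> ab t; have /andP[r0 r1] := ramp_ge0_le1 a b t ab; rewrite ger0_norm.
Qed.

(** The ramp lies between the indicators of []-oo, a]] and []-oo, b]]. *)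
Lemma Rintegral_ramp_bounds (mu : probability R R) (F : R -> R) :
  (forall x, mu `]-oo, x]%classic = (F x)%:E) ->
  forall a b, a < b -> F a <= \int[mu]_t ramp a b t <= F b.
Proof.
move=> muF a b ab.
have ir := probability_integrable_bounded mu _ _ (continuous_ramp a b) (ramp_bounded _ _ ab).
have Fi x : F x = \int[mu]_t \1_(`]-oo, x]%classic) t.
  rewrite /Rintegral integral_indic// setIT.
  exact: (congr1 fine (esym (muF x))).
have ii x : mu.-integrable setT (EFin \o (\1_(`]-oo, x]%classic) : R -> R)).
  apply: measurable_bounded_integrable => //.
  - by rewrite (le_lt_trans (probability_le1 _ _))// ltry.
  - exists 1; split => [|y y1 z _ /=]; first exact: num_real.
    by rewrite indicE; case: (_ \in _); rewrite ?normr1 ?normr0 ?ltW// (lt_trans ltr01).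
rewrite !Fi; apply/andP; split; apply: le_Rintegral => // t _; rewrite indicE.
- have [|ta] := boolP (t \in _); last by have /andP[] := ramp_ge0_le1 a b t ab.
  by rewrite inE/= in_itv/= => ta; rewrite ramp_le.
- have [|] := boolP (t \in _); first by have /andP[] := ramp_ge0_le1 a b t ab.
  by rewrite notin_setE/= in_itv/= => /negP; rewrite -ltNge => /ltW bt; rewrite ramp_ge.
Qed.

End Bounded_integrals.

(** * From the limiting means of [|phi - b|] to a limiting measure *)

Section Mean_distances.
Context {R : realType}.
Notation leb := (@lebesgue_measure R).
Context (phi : R -> R) (A : R -> R)
  (iphi : forall Y, leb.-integrable `[0, Y] (EFin \o phi))
  (cvgA : forall b, mean (fun y => `|phi y - b|) Y @[Y --> +oo] --> A b).

Let icst (d Y : R) : leb.-integrable `[0, Y] (EFin \o (fun=> d)).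
Proof. by apply: continuous_integrable_itv => x; exact: cvg_cst. Qed.

Let idist (b Y : R) : leb.-integrable `[0, Y] (EFin \o (fun y => `|phi y - b|)).
Proof.
have i : leb.-integrable `[0, Y] (EFin \o (fun y => phi y - b)) by exact: EFin_integrableB.
exact: (integrable_norm i).
Qed.

Let idist2 (a b Y : R) :
  leb.-integrable `[0, Y] (EFin \o (fun y => `|phi y - b| - `|phi y - a|)).
Proof. exact: EFin_integrableB. Qed.

(** The limiting mean of [ramp a b (phi y)], read off from the limiting means of the two distances
    in the ramp. *)
Let ell (a b : R) := (A b - A a + (b - a)) / (2 * (b - a)).

Lemma integrable_ramp_comp (a b Y : R) :
  leb.-integrable `[0, Y] (EFin \o (fun y => ramp a b (phi y))).
Proof.
rewrite (_ : (fun _ => _) = (fun y => (2 * (b - a))^-1 *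
   (`|phi y - b| - `|phi y - a| + (b - a)))).
  by apply: EFin_integrableZ => //; apply: EFin_integrableD.
by apply/funext => y; rewrite /ramp mulrC.
Qed.

Lemma cvg_mean_ramp (a b : R) : a < b ->
  mean (fun y => ramp a b (phi y)) Y @[Y --> +oo] --> ell a b.
Proof.
move=> ab; rewrite /ell [_ / _]mulrC.
have : (2 * (b - a))^-1 * (mean (fun y => `|phi y - b|) Y - mean (fun y => `|phi y - a|) Y + (b - a)) @[Y --> +oo]
   --> (2 * (b - a))^-1 * (A b - A a + (b - a)).
  apply: cvgM; first exact: cvg_cst.
  by apply: cvgD; [exact: cvgB|exact: cvg_cst].
apply: cvg_trans; apply: near_eq_cvg; near=> Y.
have Y0 : 0 < Y by near: Y; exact: nbhs_pinfty_gt.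
have -> : mean (fun y => ramp a b (phi y)) Y =
    (2 * (b - a))^-1 * mean (fun y => `|phi y - b| - `|phi y - a| + (b - a)) Y.
  rewrite -meanZ; last exact: EFin_integrableD.
  by congr (mean _ Y); apply/funext => y; rewrite /ramp mulrC.
congr (_ * _); rewrite meanD// mean_cst//; congr (_ + _).
by rewrite /mean RintegralB// mulrBr.
Unshelve. all: end_near. Qed.

(** The ramps are ordered pointwise: the first vanishes beyond [b], and the second equals 1 up to
    [a' >= b]. *)
Let ell_le a b a' b' : a < b -> b <= a' -> a' < b' -> ell a b <= ell a' b'.
Proof.
move=> ab ba' ab'; apply: ler_cvg_to (cvg_mean_ramp _ _ ab) (cvg_mean_ramp _ _ ab') _.
near=> Y; have Y0 : 0 < Y by near: Y; exact: nbhs_pinfty_gt.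
apply: le_mean => //; try exact: integrable_ramp_comp.
move=> y; have [bt|tb] := leP b (phi y).
  by rewrite ramp_ge//; have /andP[] := ramp_ge0_le1 a' b' (phi y) ab'.
rewrite [leRHS]ramp_le//; last by rewrite (le_trans (ltW tb)).
by have /andP[] := ramp_ge0_le1 a b (phi y) ab.
Unshelve. all: end_near. Qed.

Let ell01 a b : a < b -> 0 <= ell a b <= 1.
Proof.
move=> ab; apply/andP; split.
  apply: ler_cvg_to (cvg_cst (0 : R)) (cvg_mean_ramp _ _ ab) _; near=> Y.
  have Y0 : 0 < Y by near: Y; exact: nbhs_pinfty_gt.
  rewrite -(mean_cst 0 Y Y0); apply: le_mean => //; first exact: integrable_ramp_comp.
  by move=> y; have /andP[] := ramp_ge0_le1 a b (phi y) ab.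
apply: ler_cvg_to (cvg_mean_ramp _ _ ab) (cvg_cst (1 : R)) _; near=> Y.
have Y0 : 0 < Y by near: Y; exact: nbhs_pinfty_gt.
rewrite -(mean_cst 1 Y Y0); apply: le_mean => //; first exact: integrable_ramp_comp.
by move=> y; have /andP[] := ramp_ge0_le1 a b (phi y) ab.
Unshelve. all: end_near. Qed.

(** Triangle inequality under the mean; [A 0] is the limiting mean of [|phi|] and controls the mass
    far out. *)
Let A_dist b : `|A b - `|b| | <= A 0.
Proof.
have h : `|mean (fun y => `|phi y - b|) Y - `|b| | @[Y --> +oo] --> `|A b - `|b| |.
  by apply: cvg_norm; apply: cvgB => //; exact: cvg_cst.
apply: ler_cvg_to h (cvgA 0) _; near=> Y.
have Y0 : 0 < Y by near: Y; exact: nbhs_pinfty_gt.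
rewrite -[X in _ - X](mean_cst _ Y Y0); apply: mean_dist_le => // y.
by rewrite subr0 -[`|b|]normrN (le_trans (ler_dist_dist _ _))// opprK subrK.
Unshelve. all: end_near. Qed.

(** A Markov-type bound: [A a] and [A b] differ from [- a] and [- b] by at most [A 0], so the
    numerator of [ell] is at most [2 A 0]. With [ell_right] it gives tightness. *)
Let ell_left a b : a < b -> b <= 0 -> ell a b <= A 0 / (b - a).
Proof.
move=> ab b0; rewrite /ell.
have ba : 0 < b - a by rewrite subr_gt0.
have := A_dist b; have := A_dist a.
rewrite (ler0_norm b0) (ler0_norm (le_trans (ltW ab) b0)) !ler_norml => /andP[h1 h2] /andP[h3 h4].
rewrite (_ : A 0 / (b - a) = (2 * A 0) / (2 * (b - a))); last by field; rewrite gt_eqF.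
rewrite ler_pM2r ?invr_gt0 ?mulr_gt0//; lra.
Qed.

Let ell_right a b : a < b -> 0 <= a -> 1 - A 0 / (b - a) <= ell a b.
Proof.
move=> ab a0; rewrite /ell.
have ba : 0 < b - a by rewrite subr_gt0.
have := A_dist b; have := A_dist a.
rewrite (ger0_norm a0) (ger0_norm (le_trans a0 (ltW ab))) !ler_norml => /andP[h1 h2] /andP[h3 h4].
rewrite (_ : 1 - A 0 / (b - a) = (2 * (b - a) - 2 * A 0) / (2 * (b - a)));
  last by field; rewrite gt_eqF.
rewrite ler_pM2r ?invr_gt0 ?mulr_gt0//; lra.
Qed.

(* Requiring x < a strictly makes F right-continuous. *)
Let F (x : R) := inf [set z | exists a b, [/\ x < a, a < b & z = ell a b]].

Let F_inf x : has_inf [set z | exists a b, [/\ x < a, a < b & z = ell a b]].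
Proof.
split; first by exists (ell (x + 1) (x + 2)), (x + 1), (x + 2); split=> //; lra.
by exists 0 => _ [a [b [xa ab ->]]]; have /andP[] := ell01 _ _ ab.
Qed.

(** Together with [ell_le_F] this sandwiches [F] between ramps on either side of [x], which
    transfers bounds on [ell] to [F]. *)
Let F_le_ell x a b : x < a -> a < b -> F x <= ell a b.
Proof. by move=> xa ab; apply: ge_inf; [exact: (F_inf x).2|exists a, b]. Qed.

Let ell_le_F x a b : a < b -> b <= x -> ell a b <= F x.
Proof.
move=> ab bx; apply: lb_le_inf; first exact: (F_inf x).1.
by move=> _ [a' [b' [xa ab' ->]]]; apply: ell_le => //; rewrite (le_trans bx)// ltW.
Qed.

Let F01 x : 0 <= F x <= 1.
Proof.
apply/andP; split.
  have x1 : x - 1 < x by lra.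
  by apply: le_trans (ell_le_F _ _ _ x1 (lexx x)); have /andP[] := ell01 _ _ x1.
have x1 : x + 1 < x + 2 by lra.
by apply: le_trans (F_le_ell x _ _ _ x1) _; [lra|have /andP[] := ell01 _ _ x1].
Qed.

Let F_nd : {homo F : x y / x <= y}.
Proof.
move=> x y xy; apply: lb_le_inf; first exact: (F_inf y).1.
by move=> _ [a [b [ya ab ->]]]; apply: F_le_ell => //; rewrite (le_lt_trans xy).
Qed.

Let F_rc : right_continuous F.
Proof.
move=> x; apply/cvgrPdist_lt => e e0.
(* A ramp nearly attaining the infimum at [x] stays admissible for every [y] in []x, a[]. *)
have [_ [a [b [xa ab ->]]] Fe] := inf_adherent e0 (F_inf x).
near=> y; have xy : x < y by near: y; exact: nbhs_right_gt.
have ya : y < a by near: y; exact: nbhs_right_lt.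
rewrite distrC ger0_norm ?subr_ge0 ?F_nd ?ltW//.
by rewrite ltrBlDl (le_lt_trans (F_le_ell _ _ _ ya ab)).
Unshelve. all: end_near. Qed.

Let F_Ny : F @ -oo --> (0 : R).
Proof.
apply/cvgrPdist_le => e e0; near=> x.
have x0 : x < 0 by near: x; exact: nbhs_ninfty_lt.
rewrite sub0r normrN ger0_norm; last by have /andP[] := F01 x.
(* The ramp on [[x / 2, 0]] lies to the right of [x] and has length [|x| / 2], so its limiting mean
   is [O(1 / |x|)]. *)
have x20 : x / 2 < 0 by lra.
rewrite (le_trans (F_le_ell x (x / 2) 0 _ x20))//; first lra.
rewrite (le_trans (ell_left _ _ x20 (lexx _)))// ler_pdivrMr; last lra.
rewrite -ler_pdivrMl// sub0r lerNr.
rewrite ler_pdivrMr//; near: x; apply: nbhs_ninfty_le; exact: num_real.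
Unshelve. all: end_near. Qed.

Let F_y : F @ +oo --> (1 : R).
Proof.
apply/cvgrPdist_le => e e0; near=> x.
have x0 : 0 < x by near: x; exact: nbhs_pinfty_gt.
rewrite ger0_norm; last by have /andP[] := F01 x; rewrite subr_ge0.
have x2 : x / 2 < x by lra.
have x20 : 0 <= x / 2 by lra.
have := le_trans (ell_right _ _ x2 x20) (ell_le_F _ _ _ x2 (lexx _)).
suff : A 0 / (x - x / 2) <= e by lra.
rewrite ler_pdivrMr; last lra.
rewrite -ler_pdivrMl// (_ : x - x / 2 = x / 2); last by field.
rewrite ler_pdivlMr//; near: x; apply: nbhs_pinfty_ge; exact: num_real.
Unshelve. all: end_near. Qed.

Lemma limit_measure_of_ramps : exists mu : probability R R,
  [/\ forall a b, a < b ->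
        mean (fun y => ramp a b (phi y)) Y @[Y --> +oo] --> \int[mu]_t ramp a b t,
      forall K, 0 < K -> \int[mu]_t ramp (- (2 * K)) (- K) t <= A 0 / K &
      forall K, 0 < K -> 1 - \int[mu]_t ramp K (2 * K) t <= A 0 / K].
Proof.
have [mu muF] := probability_of_cdf F F_nd F_rc F_Ny F_y.
(* With [U = (A - D) / 2], [U v - U u] is [v - u] times the difference of the two sides at [u], [v].
   Both sides lie between [F (u - (v - u))] and [F v], so [subdivision_constant] makes [U]
   constant. *)
have ell_int a b : a < b -> ell a b = \int[mu]_t ramp a b t.
  (* Subtracting [|t|] keeps the integrand bounded by [|x|], so no first moment of [mu] has to be
     known. *)
  pose D x := \int[mu]_t (`|t - x| - `|t|).
  have iD x : mu.-integrable setT (EFin \o (fun t => `|t - x| - `|t|)).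
    apply: (probability_integrable_bounded _ _ `|x|).
      move=> t; apply: cvgB; apply: cvg_norm; last exact: cvg_id.
      by apply: cvgB; [exact: cvg_id|exact: cvg_cst].
    by move=> t; rewrite (le_trans (ler_dist_dist _ _))// addrC addrA addNr sub0r normrN.
  have ic d : mu.-integrable setT (EFin \o (fun=> d)).
    by apply: (probability_integrable_bounded _ _ `|d|) => // t; exact: cvg_cst.
  have Ir u v : \int[mu]_t ramp u v t = (D v - D u + (v - u)) / (2 * (v - u)).
    rewrite -[X in _ + X](probability_Rintegral_cst mu) /D -RintegralB// -RintegralD//;
      last exact: EFin_integrableB.
    rewrite mulrC -RintegralZl//; last by apply: EFin_integrableD => //; exact: EFin_integrableB.
    by apply: eq_Rintegral => t _; rewrite /ramp mulrC; congr (_ * (_ + _)); ring.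
  move=> ab; rewrite Ir /ell; congr (_ * _); congr (_ + _).
  suff : (A a - D a) / 2 = (A b - D b) / 2 by lra.
  apply: (subdivision_constant (fun x => (A x - D x) / 2) F F01 _ _ _ ab) => u v uv.
  have vu : 0 < v - u by lra.
  rewrite (_ : _ - _ = (v - u) * (ell u v - \int[mu]_t ramp u v t)); last first.
    by rewrite Ir /ell; field; rewrite gt_eqF.
  rewrite normrM gtr0_norm// ler_pM2l//.
  have /andP[h1 h2] := Rintegral_ramp_bounds mu F muF _ _ uv.
  have h3 := ell_le_F _ _ _ uv (lexx v).
  have h4 : F (u - (v - u)) <= ell u v by apply: F_le_ell => //; lra.
  have h5 : F (u - (v - u)) <= F u by apply: F_nd; lra.
  by rewrite ler_norml; apply/andP; split; lra.
exists mu; split=> [a b ab|K K0|K K0]; first by rewrite -ell_int//; exact: cvg_mean_ramp.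
- have h : - (2 * K) < - K by lra.
  rewrite -ell_int// (le_trans (ell_left _ _ h _))//; first lra.
  by rewrite (_ : - K - - (2 * K) = K)//; ring.
- have h : K < 2 * K by lra.
  rewrite -ell_int//; have := ell_right _ _ h (ltW K0).
  by rewrite (_ : 2 * K - K = K); [lra|ring].
Qed.

End Mean_distances.

(** * Approximation of bounded continuous functions by ramps *)

Section Ramp_combinations.
Context {R : realType}.

Inductive ramp_comb : (R -> R) -> Prop :=
| ramp_comb_cst c : ramp_comb (fun=> c)
| ramp_comb_ramp c a b : a < b -> ramp_comb (fun t => c * ramp a b t)
| ramp_combD f g : ramp_comb f -> ramp_comb g -> ramp_comb (fun t => f t + g t).

Lemma ramp_comb_continuous f : ramp_comb f -> continuous f.
Proof.
elim=> [c|c a b _|g h _ ig _ ih] x.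
- exact: cvg_cst.
- by apply: cvgM; [exact: cvg_cst|exact: continuous_ramp].
- by apply: cvgD; [exact: ig|exact: ih].
Qed.

Lemma ramp_comb_bounded f : ramp_comb f -> exists M, forall t, `|f t| <= M.
Proof.
elim=> [c|c a b ab|g h _ [M gM] _ [N hN]].
- by exists `|c|.
- by exists `|c| => t; rewrite normrM ler_piMr// ramp_bounded.
- by exists (M + N) => t; rewrite (le_trans (ler_normD _ _))// lerD.
Qed.

(* Agreement with f at and beyond the endpoints allows gluing such h on adjacent
   intervals. *)
Definition ramp_interpolation (f : R -> R) (e a b : R) : Prop :=
  exists h, [/\ ramp_comb h, forall t, t <= a -> h t = f a,
    forall t, b <= t -> h t = f b & forall t, a <= t <= b -> `|f t - h t| <= e].

Lemma ramp_interpolation_refl f e a : 0 <= e -> ramp_interpolation f e a a.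
Proof.
move=> e0; exists (fun=> f a); split=> //; first exact: ramp_comb_cst.
by move=> t; rewrite -eq_le => /eqP->; rewrite subrr normr0.
Qed.

Lemma ramp_interpolation_trans f e a b c : a <= b -> b <= c ->
  ramp_interpolation f e a b -> ramp_interpolation f e b c ->
  ramp_interpolation f e a c.
Proof.
move=> ab bc [h1 [r1 l1 u1 i1]] [h2 [r2 l2 u2 i2]].
(* On each side of [b], one of [h1], [h2] is the constant [f b], which the correction cancels. *)
exists (fun t => (h1 t + h2 t) + - f b); split.
- by apply: ramp_combD; [exact: ramp_combD|exact: ramp_comb_cst].
- by move=> t ta; rewrite l1// l2 ?addrK// (le_trans ta).
- by move=> t ct; rewrite u1 ?(le_trans bc)// u2// [f b + _]addrC addrK.
move=> t /andP[at_ tc]; have [tb|/ltW bt] := leP t b.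
  by rewrite l2// addrK i1// at_.
by rewrite u1// [f b + _]addrC addrK i2// bt.
Qed.

(** A single ramp from [f a] to [f b] suffices; its error is made of two increments of [f] from [a],
    hence the [e / 2]. *)
Lemma ramp_interpolation_small f e a b : a < b ->
  (forall t, a <= t <= b -> `|f t - f a| <= e / 2) -> ramp_interpolation f e a b.
Proof.
move=> ab fe; exists (fun t => f b + (f a - f b) * ramp a b t); split.
- by apply: ramp_combD; [exact: ramp_comb_cst|exact: ramp_comb_ramp].
- by move=> t ta; rewrite ramp_le// mulr1 addrC subrK.
- by move=> t bt; rewrite ramp_ge// mulr0 addr0.
move=> t tab; have /andP[r0 r1] := ramp_ge0_le1 a b t ab.
have h1 := fe _ tab; have h2 : `|f b - f a| <= e / 2 by apply: fe; rewrite lexx ltW.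
rewrite /= (_ : f t - (f b + (f a - f b) * ramp a b t) = (f t - f a) - (f b - f a) * (1 - ramp a b t));
  last by ring.
rewrite (le_trans (ler_normB _ _))// [leRHS]splitr lerD//.
by rewrite normrM (le_trans _ h2)// ler_piMr// ger0_norm; lra.
Qed.

(** Supremum argument: let [c] be the supremum of the endpoints reached from [a]. Continuity at [c]
    allows one more small ramp across [c], so the process can only stop at [b]. *)
Lemma ramp_interpolation_continuous f e a b : 0 < e -> continuous f -> a <= b ->
  ramp_interpolation f e a b.
Proof.
move=> e0 cf ab; pose S := [set x | a <= x <= b /\ ramp_interpolation f e a x].
have Sa : S a by split; [rewrite lexx|exact/ramp_interpolation_refl/ltW].
have Sub : has_sup S by split; [exists a|exists b => x /= [/andP[_ xb] _]].
set c := sup S; have ac : a <= c by exact: (sup_upper_bound Sub).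
have cb : c <= b by apply: ge_sup; [exists a|move=> x /= [/andP[_ xb] _]].
have e4 : 0 < e / 4 by rewrite divr_gt0.
have [d /= d0 fd] : exists2 d : R, 0 < d & forall t, `|c - t| < d -> `|f c - f t| < e / 4.
  have /cvgrPdist_lt cfc := cf c; have [d /= d0 cd] := cfc _ e4.
  by exists d => // t; exact: cd.
have osc s t : `|c - s| < d -> `|c - t| < d -> `|f t - f s| <= e / 2.
  move=> /fd hs /fd ht; rewrite -(subrKA (f c)) (le_trans (ler_normD _ _))// distrC.
  lra.
have [x Sx xc] := sup_adherent d0 Sub.
have xc' : x <= c by exact: (sup_upper_bound Sub).
move: Sx => /= [/andP[ax xb] fx].
have xd : `|c - x| < d by rewrite ger0_norm ?subr_ge0//; move: xc; rewrite -/c; lra.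
(* This point is reachable; being at most the supremum [c], it cannot be [c + d / 2], so it is
   [b]. *)
pose y := Order.min b (c + d / 2).
have yb : y <= b by rewrite ge_min lexx.
have cy : c <= y by rewrite le_min cb/=; lra.
have yd : `|c - y| < d.
  rewrite distrC ger0_norm ?subr_ge0//.
  have : y <= c + d / 2 by rewrite ge_min lexx orbT.
  lra.
have Qy : ramp_interpolation f e a y.
  have [xy|yx] := ltP x y; last by rewrite (le_anti (introT andP (conj yx (le_trans xc' cy)))).
  apply: ramp_interpolation_trans fx _ => //; first exact: ltW.
  apply: ramp_interpolation_small => // t /andP[xt ty]; apply: osc => //.
  by move: xd yd; rewrite !ltr_norml => /andP[h1 h2] /andP[h3 h4]; apply/andP; split; lra.
have Sy : S y by split=> //; rewrite yb (le_trans ac cy).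
have yc : y <= c by exact: (sup_upper_bound Sub).
suff -> : b = y by [].
by move: yc; rewrite /y; case: (leP b (c + d / 2)) => //; lra.
Qed.

(** Interpolate on [[- 2K, 2K]] and extend by constants. Beyond that interval the error is at most
    [2 M], and there one of the two ramp terms equals 1. Bounding the error by ramps keeps its mean
    computable. *)
Lemma ramp_comb_approx (f : R -> R) (M e K : R) : continuous f ->
  (forall t, `|f t| <= M) -> 0 < e -> 0 < K ->
  exists2 h, ramp_comb h & forall t, `|f t - h t| <=
    e + 2 * M * (ramp (- (2 * K)) (- K) t + (1 - ramp K (2 * K) t)).
Proof.
move=> cf fM e0 K0.
have M0 : 0 <= M by exact: le_trans (fM 0).
have k1 : - (2 * K) < - K by lra.
have k2 : K < 2 * K by lra.
have [|h [rh hl hr hi]] := ramp_interpolation_continuous f e (- (2 * K)) (2 * K) e0 cf.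
  by lra.
exists h => // t.
have /andP[p0 p1] := ramp_ge0_le1 _ _ t k1.
have /andP[q0 q1] := ramp_ge0_le1 _ _ t k2.
have far s : `|f t - f s| <= 2 * M.
  by rewrite (le_trans (ler_normB _ _))// mulrDl mul1r lerD.
have [t1|t1] := leP t (- (2 * K)).
  rewrite hl// (le_trans (far _))// ramp_le// -[leLHS]add0r lerD ?(ltW e0)//.
  by rewrite ler_peMr ?mulr_ge0//; lra.
have [t2|t2] := leP (2 * K) t.
  rewrite hr// (le_trans (far _))// -[leLHS]add0r lerD ?(ltW e0)//.
  by rewrite ler_peMr ?mulr_ge0// (ramp_ge K)//; lra.
rewrite (le_trans (hi _ _)) ?(ltW t1) ?(ltW t2)// lerDl.
by rewrite mulr_ge0 ?mulr_ge0//; lra.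
Qed.

End Ramp_combinations.

(** * The limiting distribution of an almost periodic function *)

Section B2_distribution.
Context {R : realType}.
Notation leb := (@lebesgue_measure R).

Lemma measurable_comp_continuous (phi f : R -> R) (D : set (measurableTypeR R)) :
  measurable_fun D phi -> continuous f -> measurable_fun D (fun y => f (phi y)).
Proof. by move=> mphi cf; apply: measurableT_comp => //; exact: continuous_measurable_fun. Qed.

Lemma integrable_comp_bounded (phi f : R -> R) (M Y : R) :
  measurable_fun (`[0%R, +oo[ : set R) phi -> continuous f ->
  (forall t, `|f t| <= M) -> leb.-integrable `[0, Y] (EFin \o (fun y => f (phi y))).
Proof.
move=> mphi cf fM; apply: measurable_bounded_integrable => //.
- by rewrite /= lebesgue_measure_itv/=; case: ifP => // _; rewrite ltry.
- apply: measurable_comp_continuous => //; exact: measurable_fun_itv_bnd mphi.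
- exists M; split=> [|x Mx y _]; first exact: num_real.
  by rewrite /= (le_trans (fM _))// ltW.
Qed.

Theorem B2_limiting_distribution (phi : R -> R) :
  measurable_fun (`[0%R, +oo[ : set R) phi -> B2_almost_periodic phi ->
  has_limiting_distribution phi.
Proof.
move=> mphi B2; pose A b := lim (mean (fun y => `|phi y - b|) Y @[Y --> +oo]).
have cvgA b : mean (fun y => `|phi y - b|) Y @[Y --> +oo] --> A b.
  exact: B2_cvg_mean_dist.
have iphi Y := B2_integrable phi Y mphi B2.
have [mu [mu_ramp mul mur]] := limit_measure_of_ramps phi A iphi cvgA.
have cmean h : ramp_comb h -> mean (fun y => h (phi y)) Y @[Y --> +oo] --> \int[mu]_t h t.
  elim=> [c|c a b ab|g1 g2 r1 i1 r2 i2].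
  - rewrite probability_Rintegral_cst; apply/cvgrPdist_le => e e0; near=> Y.
    by rewrite mean_cst ?subrr ?normr0 ?ltW//; near: Y; exact: nbhs_pinfty_gt.
  - rewrite RintegralZl//; last first.
      by apply: probability_integrable_bounded; [exact: continuous_ramp|exact: ramp_bounded].
    rewrite (_ : (fun Y => _) = (fun Y => c * mean (fun y => ramp a b (phi y)) Y)); last first.
      by apply/funext => Y; rewrite meanZ//; exact: integrable_ramp_comp.
    by apply: cvgM; [exact: cvg_cst|exact: mu_ramp].
  - have [M1 hM1] := ramp_comb_bounded _ r1.
    have [M2 hM2] := ramp_comb_bounded _ r2.
    have c1 := ramp_comb_continuous _ r1.
    have c2 := ramp_comb_continuous _ r2.
    rewrite RintegralD//; last 2 first.
    + by apply: probability_integrable_bounded hM1.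
    + by apply: probability_integrable_bounded hM2.
    rewrite (_ : (fun Y => _) = (fun Y => mean (fun y => g1 (phi y)) Y + mean (fun y => g2 (phi y)) Y)).
      exact: cvgD.
    by apply/funext => Y; rewrite meanD//;
      [apply: integrable_comp_bounded hM1|apply: integrable_comp_bounded hM2].
exists mu => f cf [M fM].
have M0 : 0 <= M by exact: le_trans (fM 0).
have imu := probability_integrable_bounded mu f M cf fM.
have iY Y := integrable_comp_bounded phi f M Y mphi cf fM.
suff cf' : mean (fun y => f (phi y)) Y @[Y --> +oo] --> \int[mu]_t f t.
  rewrite (_ : (\int[mu]_x (f x)%:E)%E = (\int[mu]_t f t)%:E); last first.
    by rewrite /Rintegral fineK//; exact: integrable_fin_num.
  rewrite (_ : (fun Y => _) = (fun Y => (mean (fun y => f (phi y)) Y)%:E)).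
    by apply: cvg_EFin => //; near=> Y.
  apply/funext => Y; rewrite /mean EFinM; congr (_ * _)%E.
  by rewrite /Rintegral fineK//; exact: integrable_fin_num (iY Y).
apply/cvgrPdist_le => e e0.
have A00 : 0 <= A 0.
  apply: ler_cvg_to (cvg_cst (0 : R)) (cvgA 0) _; near=> Y.
  have Y0 : 0 < Y by near: Y; exact: nbhs_pinfty_gt.
  by rewrite /mean mulr_ge0 ?invr_ge0 ?(ltW Y0)// Rintegral_ge0.
(* Makes each tail contribution [2 M A 0 / K] at most [e / 16]; the added ones keep [K] positive. *)
pose K := 32 * (M + 1) * (A 0 + 1) / e.
have K0 : 0 < K by rewrite /K divr_gt0// !mulr_gt0// ltr_wpDl.
have e8 : 0 < e / 8 by rewrite divr_gt0.
have [h rh fh] := ramp_comb_approx f M (e / 8) K cf fM e8 K0.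
(* The error bound rewritten as a ramp combination, so that [cmean] applies to it too. *)
pose w t := e / 8 + (2 * M * ramp (- (2 * K)) (- K) t + (2 * M + - (2 * M) * ramp K (2 * K) t)).
have k1 : - (2 * K) < - K by lra.
have k2 : K < 2 * K by lra.
have rw : ramp_comb w.
  apply: ramp_combD; first exact: ramp_comb_cst.
  apply: ramp_combD; first exact: ramp_comb_ramp.
  by apply: ramp_combD; [exact: ramp_comb_cst|exact: ramp_comb_ramp].
have {}fh t : `|f t - h t| <= w t by rewrite (le_trans (fh t))// /w; lra.
have [Mh hMh] := ramp_comb_bounded _ rh.
have [Mw hMw] := ramp_comb_bounded _ rw.
have ch := ramp_comb_continuous _ rh.
have cw := ramp_comb_continuous _ rw.
have iwmu := probability_integrable_bounded mu w Mw cw hMw.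
have ihmu := probability_integrable_bounded mu h Mh ch hMh.
have Iw : \int[mu]_t w t <= e / 4.
  have ic d : mu.-integrable setT (EFin \o (fun=> d)).
    by apply: (probability_integrable_bounded _ _ `|d|) => // t; exact: cvg_cst.
  have ir a b d : a < b -> mu.-integrable setT (EFin \o (fun t => d * ramp a b t)).
    move=> ab; apply: EFin_integrableZ => //.
    by apply: probability_integrable_bounded; [exact: continuous_ramp|exact: ramp_bounded].
  have ir1 a b : a < b -> mu.-integrable setT (EFin \o ramp a b).
    by move=> ab; apply: probability_integrable_bounded; [exact: continuous_ramp|exact: ramp_bounded].
  have i2 : mu.-integrable setT (EFin \o (fun t => 2 * M + - (2 * M) * ramp K (2 * K) t)).
    by apply: EFin_integrableD => //; exact: ir.
  have i1 := ir (- (2 * K)) (- K) (2 * M) k1.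
  have i3 : mu.-integrable setT (EFin \o (fun t => 2 * M * ramp (- (2 * K)) (- K) t +
    (2 * M + - (2 * M) * ramp K (2 * K) t))) by exact: EFin_integrableD.
  rewrite /w RintegralD// RintegralD// RintegralD//; last exact: ir.
  rewrite !probability_Rintegral_cst !RintegralZl//; do ?exact: ir1.
  have h1 := mul _ K0; have h2 := mur _ K0.
  have h3 : 2 * M * (A 0 / K) <= e / 16.
    rewrite mulrA ler_pdivrMr// (_ : e / 16 * K = 2 * ((M + 1) * (A 0 + 1))); first nra.
    by rewrite /K; field; rewrite gt_eqF.
  have h4 : 2 * M * \int[mu]_t ramp (- (2 * K)) (- K) t <= e / 16.
    by rewrite (le_trans _ h3)// ler_wpM2l// mulr_ge0.
  have h5 : 2 * M * (1 - \int[mu]_t ramp K (2 * K) t) <= e / 16.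
    by rewrite (le_trans _ h3)// ler_wpM2l// mulr_ge0.
  by lra.
have Ifh : `|\int[mu]_t f t - \int[mu]_t h t| <= \int[mu]_t w t.
  have ifh : mu.-integrable setT (EFin \o (fun t => f t - h t)) by exact: EFin_integrableB.
  rewrite -RintegralB// (le_trans (le_normr_Rintegral _ ifh))//.
  by apply: le_Rintegral => //; exact: (integrable_norm ifh).
have /cvgrPdist_le/(_ _ e8) hw := cmean _ rw.
have /cvgrPdist_le/(_ _ e8) hh := cmean _ rh.
(* The total error is at most [e / 4] for replacing [f] by [h] under [mu], [e / 8] for the mean of
   [h], and [e / 4 + e / 8] for the mean of [w]. *)
apply: filterS3 (nbhs_pinfty_gt (num_real 0)) hw hh => Y Y0 m2 m3.
have m1 : `|mean (fun y => f (phi y)) Y - mean (fun y => h (phi y)) Y| <= mean (fun y => w (phi y)) Y.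
  apply: mean_dist_le => //; first by apply: integrable_comp_bounded hMh.
  by apply: integrable_comp_bounded hMw.
move: m1 m2 m3 Ifh Iw; rewrite !ler_norml => /andP[? ?] /andP[? ?] /andP[? ?] /andP[? ?] ?.
by apply/andP; split; lra.
Unshelve. all: end_near. Qed.

End B2_distribution.

(** * Mean squares of finite trigonometric sums *)

Section Mean_square_of_cosine_sums.
Context {R : realType}.
Notation leb := (@lebesgue_measure R).

Lemma polar_form (z : R[i]) : exists t, forall x,
  complex.Re (z * expi x) = Normc.normc z * cos (x + t).
Proof.
case: z => a b; set n := Normc.normc _.
have n2 : n ^+ 2 = a ^+ 2 + b ^+ 2 by rewrite /n /= sqr_sqrtr// addr_ge0// sqr_ge0.
have n0 : 0 <= n by exact: sqrtr_ge0.
suff [t [ta tb]] : exists t, a = n * cos t /\ b = n * sin t.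
  by exists t => x; rewrite [LHS]/= cosD {1}ta {1}tb; ring.
have [nz|nz] := eqVneq n 0.
  exists 0; have : a ^+ 2 + b ^+ 2 = 0 by rewrite -n2 nz expr0n.
  by move/eqP; rewrite paddr_eq0 ?sqr_ge0// !sqrf_eq0 nz !mul0r => /andP[/eqP-> /eqP->].
have ngt0 : 0 < n by rewrite lt_neqAle eq_sym nz.
have an : -1 <= a / n <= 1.
  rewrite -ler_norml normrM normfV (gtr0_norm ngt0) ler_pdivrMr// mul1r.
  by rewrite -(ger0_norm n0) -ler_sqr ?nnegrE// !real_normK ?num_real// n2 lerDl sqr_ge0.
have ct : n * cos (acos (a / n)) = a by rewrite acosK// mulrC divfK.
have st : b ^+ 2 = (n * sin (acos (a / n))) ^+ 2.
  rewrite exprMn sin2cos2 mulrBr mulr1 -exprMn ct n2; ring.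
(* The arccosine fixes the argument of [z] up to sign; the sign of [b] decides. *)
move/eqP: st; rewrite eqf_sqr => /orP[/eqP bE|/eqP bE].
  by exists (acos (a / n)); rewrite ct.
by exists (- acos (a / n)); rewrite cosN sinN ct mulrN.
Qed.

Lemma continuous_sum (I : Type) (s : seq I) (F : I -> R -> R) :
  (forall i, continuous (F i)) -> continuous (fun y => \sum_(i <- s) F i y).
Proof.
move=> cF; elim: s => [|i s ih] y.
  rewrite (_ : (fun _ => _) = (fun=> 0)); first exact: cvg_cst.
  by apply/funext => z; rewrite big_nil.
rewrite (_ : (fun _ => _) = (fun y => F i y + \sum_(i <- s) F i y)).
  by apply: cvgD; [exact: cF|exact: ih].
by apply/funext => z; rewrite big_cons.
Qed.

Lemma Rintegral_sum (I : Type) (s : seq I) (F : I -> R -> R) (a b : R) :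
  (forall i, continuous (F i)) ->
  \int[leb]_(y in `[a, b]) (\sum_(i <- s) F i y) =
  \sum_(i <- s) \int[leb]_(y in `[a, b]) F i y.
Proof.
move=> cF; elim: s => [|i s ih].
  rewrite big_nil -[RHS](mul0r (fine (leb `[a, b]%classic))) -Rintegral_cst//.
  by apply: eq_Rintegral => y _; rewrite big_nil.
rewrite big_cons -ih -RintegralD//; last 2 first.
- exact: continuous_integrable_itv.
- by apply: continuous_integrable_itv; exact: continuous_sum.
by apply: eq_Rintegral => y _; rewrite big_cons.
Qed.

(** Expanding the square gives cosines of frequencies [lam i - lam j] and [lam i + lam j]. As
    frequencies are positive, the sum dominates the difference, so one kernel bounds both. *)
Lemma Rintegral_sqr_cos_sum_le (I : Type) (s : seq I) (rho lam theta : I -> R)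
    (kappa : I -> I -> R) (a b : R) :
  (forall i, 0 <= rho i) -> (forall i, 0 < lam i) ->
  (forall i j m t, `|lam i - lam j| <= `|m| ->
    `|\int[leb]_(y in `[a, b]) cos (m * y + t)| <= kappa i j) ->
  \int[leb]_(y in `[a, b]) (\sum_(i <- s) rho i * cos (lam i * y + theta i)) ^+ 2 <=
  \sum_(i <- s) \sum_(j <- s) rho i * rho j * kappa i j.
Proof.
move=> rho0 lam0 hk.
pose F i j y := rho i * rho j / 2 * cos ((lam i - lam j) * y + (theta i - theta j)) +
  rho i * rho j / 2 * cos ((lam i + lam j) * y + (theta i + theta j)).
have cc m t c : continuous (fun y : R => c * cos (m * y + t)).
  by move=> y; apply: cvgM; [exact: cvg_cst|exact: continuous_cos_affine].
have cF i j : continuous (F i j) by move=> y; apply: cvgD; exact: cc.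
have -> : \int[leb]_(y in `[a, b]) (\sum_(i <- s) rho i * cos (lam i * y + theta i)) ^+ 2 =
    \sum_(i <- s) \sum_(j <- s) \int[leb]_(y in `[a, b]) F i j y.
  under [RHS]eq_bigr do rewrite -Rintegral_sum//.
  rewrite -Rintegral_sum; last by move=> i; exact: continuous_sum.
  apply: eq_Rintegral => y _; rewrite expr2 mulr_suml; apply: eq_bigr => i _.
  rewrite mulr_sumr; apply: eq_bigr => j _; rewrite /F.
  rewrite (_ : (lam i - lam j) * y + (theta i - theta j) = (lam i * y + theta i) - (lam j * y + theta j));
    last by ring.
  rewrite (_ : (lam i + lam j) * y + (theta i + theta j) = (lam i * y + theta i) + (lam j * y + theta j));
    last by ring.
  by move: (lam i * y + theta i) (lam j * y + theta j) => u v; rewrite cosB cosD; field.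
apply: ler_sum => i _; apply: ler_sum => j _.
have ci m t c : leb.-integrable `[a, b] (EFin \o (fun y => c * cos (m * y + t))).
  exact: continuous_integrable_itv.
have c0 : 0 <= rho i * rho j / 2 by rewrite divr_ge0 ?mulr_ge0.
have k1 : \int[leb]_(y in `[a, b]) cos ((lam i - lam j) * y + (theta i - theta j)) <= kappa i j.
  by apply: le_trans (ler_norm _) _; exact: hk.
have k2 : \int[leb]_(y in `[a, b]) cos ((lam i + lam j) * y + (theta i + theta j)) <= kappa i j.
  apply: le_trans (ler_norm _) _; apply: hk.
  by rewrite (le_trans (ler_normB _ _))// !gtr0_norm ?addr_gt0.
have cci m t : leb.-integrable `[a, b] (EFin \o (fun y => cos (m * y + t))).
  by apply: continuous_integrable_itv; exact: continuous_cos_affine.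
rewrite /F RintegralD// !RintegralZl// -mulrDr (@le_trans _ _ (rho i * rho j / 2 * (kappa i j + kappa i j)))//.
  by rewrite ler_wpM2l// lerD.
by rewrite le_eqVlt; apply/orP; left; apply/eqP; field.
Qed.

Lemma harmonic_le_ln (n : nat) : \sum_(0 <= d < n.+1) (d.+1%:R : R)^-1 <= 1 + ln n.+1%:R.
Proof.
elim: n => [|n ih]; first by rewrite big_nat1 invr1 ln1 addr0.
rewrite big_nat_recr//= (le_trans (lerD ih (lexx _)))// -addrA lerD2l.
rewrite -lerBrDl.
have n0 : 0 < n.+1%:R :> R by rewrite ltr0n.
have n1 : 0 < n.+2%:R :> R by rewrite ltr0n.
(* The increment bound is [ln (1 + x) <= x] at [x = - 1 / (n + 2)]. *)
rewrite -lerN2 opprB -ln_div ?posrE//.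
have -> : n.+1%:R / n.+2%:R = 1 + - (n.+2%:R)^-1 :> R.
  by rewrite -[n.+2%:R]natr1; move: n.+1%:R n0 => x x0; field; rewrite gt_eqF// addr_gt0.
apply: le_ln1Dx; rewrite ltrN2 invf_lt1// ltr1n//.
Qed.

(* Bounds the integral of cos (m y + t) over a subinterval of [0, L] when m is the
   difference of two frequencies lying in unit blocks whose indices differ by d. *)
Definition gap_kernel (L : R) (d : nat) : R := if d is d'.+2 then 2 / d'.+1%:R else L.

Lemma gap_kernel_ge0 L d : 0 <= L -> 0 <= gap_kernel L d.
Proof. by case: d => [|[|d]] //= _; rewrite divr_ge0. Qed.

Lemma sum_gap_kernel_le L n : \sum_(0 <= d < n.+3) gap_kernel L d <= 2 * L + 2 * (1 + ln n.+1%:R).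
Proof.
rewrite 2?big_nat_recl//= addrA [2 * L]mulr_natl mulr2n lerD2l -mulr_sumr ler_pM2l//.
exact: harmonic_le_ln.
Qed.

(** Keeping only pairs with [q i <= q j] lets a decreasing block bound be evaluated at the smaller
    index. *)
Lemma sum_sym_le (s : seq nat) (q : nat -> nat) (G : nat -> nat -> R) :
  (forall i j, 0 <= G i j) -> (forall i j, G i j = G j i) ->
  \sum_(i <- s) \sum_(j <- s) G i j <=
  2 * \sum_(i <- s) \sum_(j <- s | (q i <= q j)%N) G i j.
Proof.
move=> G0 Gs.
have -> : \sum_(i <- s) \sum_(j <- s) G i j =
    \sum_(i <- s) \sum_(j <- s | (q i <= q j)%N) G i j +
    \sum_(i <- s) \sum_(j <- s | (q j < q i)%N) G i j.
  rewrite -big_split/=; apply: eq_bigr => i _.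
  rewrite (bigID (fun j => q i <= q j)%N)/=; congr (_ + _).
  by apply: eq_bigl => j; rewrite -ltnNge.
rewrite [leRHS]mulr_natl mulr2n lerD2l.
rewrite (exchange_big_dep predT)//=; apply: ler_sum => i _.
rewrite big_mkcond [leRHS]big_mkcond; apply: ler_sum => j _.
rewrite Gs; case: ltnP => [/ltnW->//|_]; case: ifP => // _.
Qed.

Lemma partition_by_value (s : seq nat) (P : pred nat) (q : nat -> nat) (B : nat) (F : nat -> R) :
  (forall j, j \in s -> P j -> (q j < B)%N) ->
  \sum_(j <- s | P j) F j = \sum_(0 <= d < B) \sum_(j <- s | P j && (q j == d)) F j.
Proof.
move=> qB; rewrite (exchange_big_dep P)/=; last by move=> ? ? _ /andP[].
rewrite big_seq_cond [RHS]big_seq_cond; apply: eq_bigr => j /andP[js Pj].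
rewrite Pj/= -big_filter (_ : [seq _ <- _ | _] = [:: q j]) ?big_seq1//.
rewrite -(filter_pred1_uniq (iota_uniq 0 B)) ?mem_iota ?qB// /index_iota subn0.
by apply: eq_filter => d /=; rewrite eq_sym.
Qed.

(** Group the [j] by the gap [d = q j - q i]: block [q i + d] has mass at most
    [w (q i + d) <= w (q i)]. *)
Lemma gap_sum_le (s : seq nat) (q : nat -> nat) (rho : nat -> R) (w : nat -> R) (L : R) (B i : nat) :
  0 <= L -> (forall j, j \in s -> (q j < B)%N) ->
  (forall k, (q i <= k)%N -> \sum_(j <- s | q j == k) rho j <= w k) ->
  (forall k, (q i <= k)%N -> w k <= w (q i)) ->
  \sum_(j <- s | (q i <= q j)%N) rho j * gap_kernel L (q j - q i)%N <=
  w (q i) * \sum_(0 <= d < B) gap_kernel L d.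
Proof.
move=> L0 qB qw wq.
rewrite (partition_by_value s _ (fun j => q j - q i)%N B); last first.
  by move=> j js _; apply: leq_ltn_trans (leq_subr _ _) (qB _ js).
rewrite mulr_sumr; apply: ler_sum => d _.
have -> : \sum_(j <- s | (q i <= q j)%N && (q j - q i == d)%N) rho j * gap_kernel L (q j - q i)%N =
    (\sum_(j <- s | q j == (q i + d)%N) rho j) * gap_kernel L d.
  rewrite mulr_suml; apply: eq_big => [j|j /andP[_ /eqP->]//].
  by apply/idP/eqP => [/andP[qij /eqP<-]|->]; rewrite ?subnKC// leq_addr addKn eqxx.
rewrite ler_wpM2r ?gap_kernel_ge0//.
have qd : (q i <= q i + d)%N by exact: leq_addr.
exact: le_trans (qw _ qd) (wq _ qd).
Qed.

End Mean_square_of_cosine_sums.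

(** * Unit blocks of frequencies and the mean square of a tail *)

Section Frequency_blocks.
Context {R : realType}.
Notation leb := (@lebesgue_measure R).

Lemma fsbig_nat_bounded (V : nmodType) (P : pred nat) (F : nat -> V) (N : nat) :
  (forall n, P n -> (n < N)%N) ->
  \sum_(n \in [set n | P n]) F n = \sum_(0 <= n < N | P n) F n.
Proof.
move=> PN; rewrite (@bigfs _ _ _ _ (index_iota 0 N) P) ?iota_uniq//.
by move=> n /PN nN; rewrite mem_index_iota nN.
Qed.

Lemma cvgy_bounded_index (lam : nat -> R) (X : R) : lam @ \oo --> +oo ->
  exists N, forall n, lam n <= X -> (n < N)%N.
Proof.
move=> /cvgryPgt/(_ X)[N _ hN]; exists N => n; apply: contraTltn => Nn.
by rewrite -ltNge; exact: hN.
Qed.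

Lemma sum_le_abs_sum (lam : nat -> R) (r : nat -> R[i]) (S T : R) (s : seq nat) :
  lam @ \oo --> +oo -> uniq s ->
  \sum_(n <- s | S < lam n <= T) Normc.normc (r n) <= abs_sum lam r S T.
Proof.
move=> lamy us; have [N hN] := cvgy_bounded_index _ T lamy.
rewrite /abs_sum (fsbig_nat_bounded _ (fun n => S < lam n <= T) _ N); last first.
  by move=> n /andP[_ /hN].
rewrite -big_filter (perm_big [seq n <- index_iota 0 N | (S < lam n <= T) && (n \in s)]);
  last first.
  apply: uniq_perm; rewrite ?filter_uniq ?iota_uniq// => n.
  rewrite !mem_filter mem_index_iota leq0n/=.
  by case: (boolP (S < lam n <= T)) => //= /andP[_ /hN ->]; rewrite andbT.
rewrite big_filter big_mkcond [leRHS]big_mkcond; apply: ler_sum => n _.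
have n0 : 0 <= Normc.normc (r n) by case: (r n) => x y; exact: sqrtr_ge0.
by case: (S < lam n <= T) => //=; case: (n \in s).
Qed.

Lemma abs_sum_subadditive (lam : nat -> R) (r : nat -> R[i]) (S T U : R) :
  lam @ \oo --> +oo -> abs_sum lam r S U <= abs_sum lam r S T + abs_sum lam r T U.
Proof.
move=> lamy; have [N hN] := cvgy_bounded_index _ U lamy.
rewrite {1}/abs_sum (fsbig_nat_bounded _ (fun n => S < lam n <= U) _ N); last first.
  by move=> n /andP[_ /hN].
have n0 n : 0 <= Normc.normc (r n) by case: (r n) => x y; exact: sqrtr_ge0.
apply: (le_trans _ (lerD (sum_le_abs_sum lam r S T _ lamy (iota_uniq 0 (N - 0)))
   (sum_le_abs_sum lam r T U _ lamy (iota_uniq 0 (N - 0))))).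
rewrite !(big_mkcond (fun n => _ < lam n <= _)) -big_split/=.
apply: ler_sum => n _; case: (leP (lam n) U) => h1; case: (leP (lam n) T) => h2;
  case: (ltP S (lam n)) => h3 //=; rewrite ?add0r ?addr0//.
Qed.

Lemma abs_sum_unit_blocks (lam : nat -> R) (r : nat -> R[i]) (m n : nat) (c : R) :
  lam @ \oo --> +oo ->
  (forall k, (m <= k)%N -> abs_sum lam r k%:R (k%:R + 1) <= c) ->
  abs_sum lam r m%:R (m + n)%:R <= n%:R * c.
Proof.
move=> lamy hc; elim: n => [|n ih].
  rewrite addn0 mul0r /abs_sum fsbig1// => k /= /andP[h1 h2].
  by have := lt_le_trans h1 h2; rewrite ltxx.
apply: (le_trans (abs_sum_subadditive _ _ _ (m + n)%:R _ lamy)).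
rewrite -[n.+1%:R]natr1 mulrDl mul1r lerD//.
by rewrite addnS -natr1; apply: hc; exact: leq_addr.
Qed.

Lemma exists_unit_block (x : R) : 0 < x -> exists k : nat, k%:R < x <= k.+1%:R.
Proof.
move=> x0; have /andP[h1 h2] := truncn_itv (ltW x0).
(* Blocks are open on the left, so an integer belongs to the block before its truncation. *)
case: (ltP (Num.truncn x)%:R x) => h; first by exists (Num.truncn x); rewrite h ltW.
have xe : x = (Num.truncn x)%:R by apply/le_anti; rewrite h h1.
move: x0; rewrite xe; case: (Num.truncn x) => [|k]; first by rewrite ltxx.
by move=> _; exists k; rewrite ltr_nat leqnn lexx.
Qed.

(* The factor Y comes from sum_(d <= e^Y) 1/d = O(Y): this is where the
   truncation at e^Y matters. *)
Lemma mean_square_block_le (lam rho theta : nat -> R) (q : nat -> nat) (w : nat -> R)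
    (k0 : nat) (eta y0 Y : R) (s : seq nat) :
  (forall n, 0 <= rho n) -> (forall n, 0 < lam n) ->
  (forall n, (q n)%:R < lam n <= (q n).+1%:R) ->
  (forall i, i \in s -> (k0 <= q i)%N) -> (forall i, i \in s -> lam i <= expR Y) ->
  (forall k, (k0 <= k)%N -> \sum_(j <- s | q j == k) rho j <= w k) ->
  (forall k l, (k0 <= k)%N -> (k <= l)%N -> w l <= w k) ->
  \sum_(i <- s) rho i * w (q i) <= eta ->
  0 <= y0 -> y0 <= Y -> 1 <= Y ->
  \int[leb]_(y in `[y0, Y]) (\sum_(i <- s) rho i * cos (lam i * y + theta i)) ^+ 2 <=
  12 * Y * eta.
Proof.
move=> rho0 lam0 hq k0q lamY qw wd weta y00 y0Y Y1.
have Y0 : 0 <= Y by lra.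
(* Subtraction is truncated: one term is 0 and the sum is [|q i - q j|]. *)
pose dist i j := ((q i - q j) + (q j - q i))%N.
pose G i j := rho i * rho j * gap_kernel Y (dist i j).
apply: (@le_trans _ _ (\sum_(i <- s) \sum_(j <- s) G i j)).
  apply: Rintegral_sqr_cos_sum_le => // i j m t hm.
  rewrite /gap_kernel; case E : (dist i j) => [|[|d]].
  - by rewrite (le_trans (Rintegral_cos_le _ _ _ _ y0Y))//; lra.
  - by rewrite (le_trans (Rintegral_cos_le _ _ _ _ y0Y))//; lra.
  (* Unit blocks whose indices differ by [d + 2] are at distance at least [d + 1]. *)
  have dm : d.+1%:R <= `|m|.
    rewrite (le_trans _ hm)//; have /andP[hi1 hi2] := hq i; have /andP[hj1 hj2] := hq j.
    have [qij|qji] := leqP (q i) (q j).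
      have qE : q j = (q i + d.+2)%N by move: E; rewrite /dist; lia.
      move: hj1 hi2; rewrite qE -!natr1 natrD -!natr1 => hj1 hi2.
      by rewrite distrC (le_trans _ (ler_norm _))//; lra.
    have qE : q i = (q j + d.+2)%N by move: E; rewrite /dist; lia.
    move: hi1 hj2; rewrite qE -!natr1 natrD -!natr1 => hi1 hj2.
    by rewrite (le_trans _ (ler_norm _))//; lra.
  have d0 : 0 < d.+1%:R :> R by rewrite ltr0n.
  have m0 : 0 < `|m| by exact: lt_le_trans dm.
  apply: (le_trans (Rintegral_cos_le_inv m t y0 Y _ y0Y)); first by rewrite -normr_gt0.
  by rewrite ler_pM2l// lef_pV2.
have gk0 d : 0 <= gap_kernel Y d by exact: gap_kernel_ge0.
apply: (le_trans (sum_sym_le s q G _ _)).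
- by move=> i j; rewrite !mulr_ge0.
- by move=> i j; rewrite /G /dist addnC [rho i * _]mulrC.
have eY1 : 1 <= expR Y by rewrite -expR0 ler_expR.
have [n nE] : exists n, Num.truncn (expR Y) = n.+1.
  by move: (truncn_gt0 (expR Y)); rewrite eY1; case: (Num.truncn _) => // n; exists n.
have /andP[n1 n2] := truncn_itv (ltW (expR_gt0 Y)); rewrite nE in n1 n2.
have qn j : j \in s -> (q j < n.+3)%N.
  move=> js; have /andP[h1 _] := hq j.
  have := lt_le_trans h1 (lamY _ js) => h2.
  by have := lt_trans h2 n2; rewrite ltr_nat => /ltnW.
(* Since [ln (n + 1) <= Y] and [Y >= 1], the bound [2 Y + 2 (1 + Y)] is at most [6 Y];
   symmetrization doubles it to the final 12. *)
have KY : \sum_(0 <= d < n.+3) gap_kernel Y d <= 6 * Y.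
  apply: (le_trans (sum_gap_kernel_le _ _)).
  have : ln n.+1%:R <= Y by rewrite -[leRHS]expRK ler_ln ?posrE ?expR_gt0.
  lra.
have K0 : 0 <= \sum_(0 <= d < n.+3) gap_kernel Y d by exact: sumr_ge0.
have : \sum_(i <- s) \sum_(j <- s | (q i <= q j)%N) G i j <=
    \sum_(i <- s) rho i * w (q i) * (6 * Y).
  rewrite big_seq [leRHS]big_seq; apply: ler_sum => i si.
  have -> : \sum_(j <- s | (q i <= q j)%N) G i j =
      rho i * \sum_(j <- s | (q i <= q j)%N) rho j * gap_kernel Y (q j - q i)%N.
    rewrite mulr_sumr; apply: eq_bigr => j qij; rewrite /G mulrA; congr (_ * gap_kernel _ _).
    by rewrite /dist; lia.
  rewrite -mulrA ler_wpM2l//.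
  have w0 : 0 <= w (q i) by apply: le_trans (qw _ (k0q _ si)); exact: sumr_ge0.
  apply: (le_trans (gap_sum_le s q rho w Y n.+3 i Y0 qn _ _)).
  - by move=> k qik; apply: qw; exact: leq_trans (k0q _ si) qik.
  - by move=> k qik; apply: wd => //; exact: k0q.
  - by rewrite ler_wpM2l.
rewrite -mulr_suml => h.
have h' : (\sum_(i <- s) rho i * w (q i)) * (6 * Y) <= eta * (6 * Y) by rewrite ler_wpM2r// mulr_ge0.
by move: (le_trans h h'); lra.
Qed.

End Frequency_blocks.

(** * Growth of the coefficients *)

Section Growth.
Context {R : realType}.

Lemma ln_powR_le (gamma e : R) : 0 <= gamma -> 0 < e ->
  exists2 C, 0 < C & forall x, 1 <= x -> ln (2 * x) `^ gamma <= C * x `^ e.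
Proof.
(* From [ln y <= y^d / d], the power [gamma] yields the exponent [d gamma <= e]; the [+ 1] covers
   [gamma = 0]. *)
move=> g0 e0; pose d := e / (gamma + 1).
have g1 : 0 < gamma + 1 by lra.
have d0 : 0 < d by rewrite divr_gt0.
exists ((d^-1) `^ gamma * 2 `^ e) => [|x x1]; first by rewrite mulr_gt0 ?powR_gt0 ?invr_gt0.
have y1 : 1 <= 2 * x by lra.
have y0 : 0 < 2 * x by lra.
have ly : ln (2 * x) <= d^-1 * (2 * x) `^ d.
  rewrite ler_pdivlMl// -ln_powR ltW// ln_sublinear// powR_gt0//.
rewrite -mulrA -powRM; [|lra|lra].
move: (2 * x) y1 y0 ly => y y1 y0 ly.
apply: (@le_trans _ _ ((d^-1 * y `^ d) `^ gamma)).
  by apply: ge0_ler_powR => //; rewrite nnegrE ?ln_ge0// mulr_ge0 ?powR_ge0// invr_ge0 ltW.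
rewrite powRM ?powR_ge0 ?invr_ge0 ?(ltW d0)// ler_wpM2l ?powR_ge0// -powRrM.
apply: ler_powR => //; rewrite /d -mulrA ler_piMr ?(ltW e0)//.
by rewrite mulrC ler_pdivrMr// mul1r; lra.
Qed.

(* C absorbs the logarithms: b is slightly less than the exponent beta of the theorem. *)
Definition power_growth (lam : nat -> R) (r : nat -> R[i]) (C a b : R) (k1 : nat) :=
  (forall k : nat, (k1 <= k)%N ->
     abs_sum lam r k%:R (k%:R + 1) <= C * k%:R `^ (- b)) /\
  (forall j : nat, (k1 <= 2 ^ j)%N ->
     abs_sum lam r (2 ^ j)%:R (2 ^ j.+1)%:R <= C * (2 ^ j)%:R `^ (a - b)).

(** A dyadic block is made of [2^j] unit blocks, each bounded as the first one, hence [a = 1]. *)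
Lemma power_growth_unit_blocks (lam : nat -> R) (r : nat -> R[i]) (beta gamma M : R) :
  lam @ \oo --> +oo -> 0 <= gamma -> 0 < M -> 1 / 2 < beta ->
  (\forall T \near +oo, abs_sum lam r T (T + 1) <= M * (ln T `^ gamma / T `^ beta)) ->
  exists C a b k1, [/\ 0 < C, 0 < b, a < 2 * b, (0 < k1)%N & power_growth lam r C a b k1].
Proof.
move=> lamy g0 M0 b2 [T0 [_ hT]].
(* With [b = beta - e], [2 b = beta + 1 / 2] still exceeds [a = 1]. *)
pose e := (beta - 1 / 2) / 2; have e0 : 0 < e by rewrite /e; lra.
have [C C0 hC] := ln_powR_le _ _ g0 e0.
pose k1 := (Num.bound T0).+1.
have k1T k : (k1 <= k)%N -> T0 < k%:R.
  move=> k1k; apply: (le_lt_trans (ler_norm _)); apply: (lt_trans (archi_boundP (normr_ge0 _))).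
  rewrite ltr_nat; move: k1k; rewrite /k1 /Num.bound normr_id; exact.
exists (M * C), 1, (beta - e), k1.
have k10 : (0 < k1)%N by [].
have unit_block k : (k1 <= k)%N -> abs_sum lam r k%:R (k%:R + 1) <= M * C * k%:R `^ (- (beta - e)).
  move=> k1k; have k0 : 0 < k%:R :> R by rewrite ltr0n (leq_trans k10).
  have kR : 1 <= k%:R :> R by rewrite ler1n (leq_trans k10).
  apply: (le_trans (hT _ (k1T _ k1k))); rewrite -mulrA ler_pM2l//.
  rewrite opprB powRB; last by apply/implyP => _; rewrite gt_eqF.
  rewrite mulrA ler_pM2r ?invr_gt0 ?powR_gt0//.
  apply: (le_trans _ (hC _ kR)); apply: ge0_ler_powR => //; rewrite ?nnegrE ?ln_ge0//; first lra.
  by rewrite ler_ln ?posrE//; lra.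
split=> //; rewrite ?mulr_gt0//; [by rewrite /e; lra|by rewrite /e; lra|].
split=> // j k1j.
have j0 : 0 < (2 ^ j)%:R :> R by rewrite ltr0n (leq_trans k10).
rewrite (_ : (2 ^ j.+1 = 2 ^ j + 2 ^ j)%N); last by rewrite expnS; lia.
rewrite powRD; last by apply/implyP => _; rewrite gt_eqF.
rewrite (powRr1 (ltW j0)) mulrCA; apply: abs_sum_unit_blocks => // k jk.
apply: (le_trans (unit_block _ (leq_trans k1j jk))).
rewrite ler_pM2l ?mulr_gt0// !powRN lef_pV2 ?posrE ?powR_gt0//; last first.
  by rewrite ltr0n (leq_trans k10)// (leq_trans k1j).
apply: ge0_ler_powR; rewrite ?nnegrE ?ler0n ?ler_nat//; rewrite /e; lra.
Qed.

Lemma power_growth_all_blocks (lam : nat -> R) (r : nat -> R[i]) (alpha beta gamma M T1 : R) :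
  0 <= gamma -> 0 < M -> 0 < alpha -> 0 < beta ->
  alpha ^+ 2 + alpha / 2 < beta ^+ 2 + beta ->
  (forall S T, T1 <= S -> S < T ->
     abs_sum lam r S T <= M * ((T - S) `^ alpha * ln T `^ gamma / S `^ beta)) ->
  exists C a b k1, [/\ 0 < C, 0 < b, a < 2 * b, (0 < k1)%N & power_growth lam r C a b k1].
Proof.
move=> g0 M0 a0 b0 ab hT.
(* If [alpha >= 2 beta], then [alpha^2 + alpha / 2 >= 4 beta^2 + beta], contradicting the
   hypothesis. *)
have ab2 : alpha < 2 * beta by nra.
pose e := (2 * beta - alpha) / 4; have e0 : 0 < e by rewrite /e; lra.
have [C C0 hC] := ln_powR_le _ _ g0 e0.
pose k1 := (Num.bound T1).+1.
have k10 : (0 < k1)%N by [].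
have k1T k : (k1 <= k)%N -> T1 <= k%:R.
  move=> k1k; apply: (le_trans (ler_norm _)); apply: (le_trans (ltW (archi_boundP (normr_ge0 _)))).
  rewrite ler_nat; move: k1k; rewrite /k1 /Num.bound normr_id; exact: ltnW.
exists (M * C), alpha, (beta - e), k1.
(* Used with [n = 1] for unit blocks and [n = k = 2^j] for dyadic ones; [n <= k] keeps the logarithm
   below [ln (2 k)]. *)
have main (k n : nat) : (k1 <= k)%N -> (0 < n <= k)%N ->
    abs_sum lam r k%:R (k%:R + n%:R) <= M * C * (n%:R `^ alpha * k%:R `^ (- (beta - e))).
  move=> k1k /andP[n0 nk]; have k0 : 0 < k%:R :> R by rewrite ltr0n (leq_trans k10).
  have kR : 1 <= k%:R :> R by rewrite ler1n (leq_trans k10).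
  have nR : 0 < n%:R :> R by rewrite ltr0n.
  have nkR : n%:R <= k%:R :> R by rewrite ler_nat.
  have kn : k%:R < k%:R + n%:R :> R by lra.
  apply: (le_trans (hT _ _ (k1T _ k1k) kn)); rewrite -[M * C * _]mulrA ler_pM2l//.
  rewrite (_ : k%:R + n%:R - k%:R = n%:R); last by ring.
  rewrite opprB powRB; last by apply/implyP => _; rewrite gt_eqF.
  rewrite mulrCA -[leLHS]mulrA ler_pM2l ?powR_gt0// mulrA ler_pM2r ?invr_gt0 ?powR_gt0//.
  apply: (le_trans _ (hC _ kR)); apply: ge0_ler_powR => //; rewrite ?nnegrE ?ln_ge0//; try lra.
  by rewrite ler_ln ?posrE//; lra.
split=> //; rewrite ?mulr_gt0//; [by rewrite /e; lra|by rewrite /e; lra|].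
split=> [k k1k|j k1j].
  have := main k 1%N k1k; rewrite (leq_trans k10 k1k) powR1 mul1r; exact.
have j0 : 0 < (2 ^ j)%:R :> R by rewrite ltr0n (leq_trans k10).
have := main (2 ^ j)%N (2 ^ j)%N k1j; rewrite leqnn (leq_trans k10 k1j) => /(_ isT).
rewrite (_ : (2 ^ j.+1)%:R = (2 ^ j)%:R + (2 ^ j)%:R);
  last by rewrite -natrD expnS; congr _%:R; lia.
by rewrite powRD//; apply/implyP => _; rewrite gt_eqF.
Qed.

Lemma sum_geometric_le (t : R) (n : nat) : 0 < t < 1 ->
  \sum_(0 <= d < n) t ^+ d <= (1 - t)^-1.
Proof.
move=> /andP[t0 t1]; have t1' : 0 < 1 - t by rewrite subr_gt0.
rewrite -[leRHS]div1r ler_pdivlMr// mulrC.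
suff -> : (1 - t) * \sum_(0 <= d < n) t ^+ d = 1 - t ^+ n by rewrite gerBl exprn_ge0// ltW.
elim: n => [|n ih]; first by rewrite big_nil mulr0 expr0 subrr.
by rewrite big_nat_recr//= mulrDr ih exprS; ring.
Qed.

(** The j-th dyadic block has mass at most [C 2^(j (a - b))] and weights at most [C 2^(- j b)], so
    it contributes at most [C^2 t^j] with [t = 2^(a - 2 b) < 1]. The bound is uniform over finite
    [s]. *)
Lemma power_growth_tail (lam : nat -> R) (r : nat -> R[i]) (q : nat -> nat) (C a b : R)
    (k1 : nat) (eta : R) :
  lam @ \oo --> +oo -> (forall n, (q n)%:R < lam n <= (q n).+1%:R) ->
  0 < C -> 0 < b -> a < 2 * b -> (0 < k1)%N -> power_growth lam r C a b k1 -> 0 < eta ->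
  exists2 k0, (k1 <= k0)%N & forall s, uniq s ->
    \sum_(n <- s | (k0 <= q n)%N) Normc.normc (r n) * (C * (q n)%:R `^ (- b)) <= eta.
Proof.
move=> lamy hq C0 b0 ab k10 [_ hD] eta0.
pose t : R := 2 `^ (a - 2 * b).
have t0 : 0 < t by exact: powR_gt0.
have t1 : t < 1.
  by rewrite -(powRr0 2) /t /powR !ifF ?pnatr_eq0// ltr_expR ltr_pM2r ?ln_gt0 ?ltr1n//; lra.
have t01 : 0 < t < 1 by rewrite t0.
have t1' : 0 < 1 - t by rewrite subr_gt0.
(* The geometric tail from [j0] on is [C^2 t^j0 / (1 - t)]. *)
have [j0 [k1j0 hj0]] : exists j0, (k1 <= 2 ^ j0)%N /\ C * C * t ^+ j0 <= eta * (1 - t).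
  have h : \forall j \near \oo, t ^+ j < eta * (1 - t) / (C * C).
    have : (fun j => t ^+ j) @ \oo --> (0 : R) by apply: cvg_expr; rewrite ger0_norm ?ltW.
    move=> /cvgrPdist_lt/(_ (eta * (1 - t) / (C * C))); rewrite divr_gt0 ?mulr_gt0// => /(_ isT).
    by apply: filterS => j; rewrite sub0r normrN ger0_norm// exprn_ge0// ltW.
  have [N _ hN] := h; exists (maxn N k1); split.
    by rewrite (leq_trans (leq_maxr N k1))// ltnW// ltn_expl.
  by rewrite mulrC -ler_pdivlMr ?mulr_gt0// ltW//; apply: hN; exact: leq_maxl.
exists (2 ^ j0)%N => // s us.
have n0 n : 0 <= Normc.normc (r n) by case: (r n) => x y; exact: sqrtr_ge0.
pose p n := (trunc_log 2 (q n) - j0)%N.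
have [B hB] : exists B, forall n, n \in s -> (p n < B)%N.
  exists (\max_(n <- s) p n).+1 => n ns; rewrite ltnS; exact: leq_bigmax_seq.
rewrite (partition_by_value s _ p B); last by move=> n /hB.
apply: (@le_trans _ _ (\sum_(0 <= d < B) C * C * t ^+ j0 * t ^+ d)); last first.
  rewrite -mulr_sumr; apply: (@le_trans _ _ (C * C * t ^+ j0 * (1 - t)^-1)).
    by rewrite ler_wpM2l ?sum_geometric_le// !mulr_ge0 ?exprn_ge0// ltW.
  by rewrite ler_pdivrMr.
apply: ler_sum => d _.
have dj : (k1 <= 2 ^ (j0 + d))%N by rewrite (leq_trans k1j0)// leq_exp2l// leq_addr.
have j0R : 0 < (2 ^ (j0 + d))%:R :> R by rewrite ltr0n expn_gt0.
apply: (@le_trans _ _ (\sum_(n <- s | (2 ^ (j0 + d))%:R < lam n <= (2 ^ (j0 + d).+1)%:R)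
    Normc.normc (r n) * (C * (2 ^ (j0 + d))%:R `^ (- b)))); last first.
  rewrite -mulr_suml.
  have := le_trans (sum_le_abs_sum lam r _ _ s lamy us) (hD _ dj) => h.
  apply: (le_trans (ler_wpM2r _ h)); first by rewrite mulr_ge0 ?powR_ge0 ?ltW.
  rewrite mulrACA -powRD; last by apply/implyP => _; rewrite gt_eqF.
  rewrite -[leRHS]mulrA ler_wpM2l ?mulr_ge0 ?(ltW C0)// -exprD.
  rewrite (_ : a - b + - b = a - 2 * b); last by ring.
  by rewrite natrX -powR_mulrn// powRAC powR_mulrn ?powR_ge0.
rewrite big_mkcond [leRHS]big_mkcond; apply: ler_sum => n _.
case: ifP => [/andP[qn /eqP pn]|_]; last first.
  by case: ifP => // _; rewrite !mulr_ge0 ?powR_ge0 ?(ltW C0).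
have q0 : (0 < q n)%N by rewrite (leq_trans _ qn)// expn_gt0.
have tq : trunc_log 2 (q n) = (j0 + d)%N.
  have : (j0 <= trunc_log 2 (q n))%N by rewrite trunc_log_max.
  by move: pn; rewrite /p; lia.
have /andP[] := trunc_log_bounds (isT : (1 < 2)%N) q0; rewrite tq => l1 l2.
have /andP[h1 h2] := hq n.
(* [2^(j0 + d) <= q n < lam n <= q n + 1 <= 2^(j0 + d + 1)]. *)
rewrite ifT; last first.
  rewrite (le_lt_trans _ h1) ?ler_nat//= (le_trans h2)// ler_nat//.
rewrite ler_wpM2l// ler_pM2l// !powRN lef_pV2 ?posrE ?powR_gt0 ?ltr0n ?expn_gt0//.
by apply: ge0_ler_powR; rewrite ?nnegrE ?ler0n ?ler_nat// ltW.
Qed.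

End Growth.

(** * The explicit formula *)

Section Explicit_formula.
Context {R : realType}.
Notation leb := (@lebesgue_measure R).

(** A cosine is a sum of two conjugate exponentials with frequencies [m] and [- m]; sums of
    polynomials concatenate the coefficient lists. *)
Lemma trigp_trig_poly (f : R -> R) : trigp f ->
  exists N a mu, forall y, trig_poly N a mu y = (f y)%:C%C.
Proof.
elim=> [a m t|g h _ [N1 [a1 [mu1 h1]]] _ [N2 [a2 [mu2 h2]]]].
  exists 2%N, (fun n => if n == 1%N then ((a / 2) * cos t +i* ((a / 2) * sin t))%C
                        else ((a / 2) * cos t -i* ((a / 2) * sin t))%C),
    (fun n => if n == 1%N then m else - m) => y.
  rewrite /trig_poly 2?big_nat_recl// big_nil addr0/=; apply/eqP.
  rewrite eq_complex/= mulNr cosN sinN cosD; by apply/andP; split; apply/eqP; field.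
exists (N1 + N2)%N, (fun n => if (n <= N1)%N then a1 n else a2 (n - N1)%N),
  (fun n => if (n <= N1)%N then mu1 n else mu2 (n - N1)%N) => y.
rewrite rmorphD/= -h1 -h2 /trig_poly (@big_cat_nat _ _ _ N1.+1) ?ltnS ?leq_addr//=.
congr (_ + _); first by apply: eq_big_nat => n /andP[_]; rewrite ltnS => ->.
rewrite -[X in \sum_(X <= _ < _) _]/(1 + N1)%N big_addn.
rewrite (_ : ((N1 + N2).+1 - N1 = N2.+1)%N); last by lia.
apply: eq_big_nat => n /andP[n0 _].
have -> : (n + N1 <= N1)%N = false by lia.
by rewrite addnK.
Qed.

Lemma ge0_integral_itv_split_le (f : R -> R) (a b d : R) : a <= b -> b <= d ->
  measurable_fun (`[a, d] : set (measurableTypeR R)) f -> (forall y, 0 <= f y) ->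
  (\int[leb]_(y in `[a, d]) (f y)%:E <=
   \int[leb]_(y in `[a, b]) (f y)%:E + \int[leb]_(y in `[b, d]) (f y)%:E)%E.
Proof.
move=> ab bd mf f0.
have E : `[a, d]%classic = (`[a, b] `|` `]b, d])%classic :> set R.
  by rewrite -itv_bndbnd_setU// bnd_simp.
have mF : measurable_fun (`[a, d] : set (measurableTypeR R)) (fun y => (f y)%:E) by exact/measurable_EFinP.
rewrite {1}E ge0_integral_setU//=.
- rewrite leeD2l// integral_itv_obnd_cbnd//.
  by apply: measurable_funS mF => //; apply: subset_itvr; rewrite bnd_simp.
- by rewrite -E.
- by move=> y _; rewrite lee_fin.
- apply/disj_setPS => y [/=]; rewrite 2!in_itv/= => /andP[_ yx] /andP[].
  by rewrite leNgt; move: yx; case: ltP => //; rewrite ltNge => /negbTE->.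
Qed.

Lemma trunc_sum_cos (lam rho theta : nat -> R) (r : nat -> R[i]) (X y : R) (N : nat) :
  (forall n x, complex.Re (r n * expi x) = rho n * cos (x + theta n)) ->
  (forall n, lam n <= X -> (n < N)%N) ->
  trunc_sum lam r X y = \sum_(0 <= n < N | lam n <= X) rho n * cos (lam n * y + theta n).
Proof.
move=> hr hN; rewrite /trunc_sum (fsbig_nat_bounded _ (fun n => lam n <= X) _ N)//.
by rewrite Re_sum; apply: eq_bigr => n _; rewrite hr.
Qed.

Lemma sqr_integrable_sub_continuous (phi P : R -> R) (b : R) : 0 <= b ->
  measurable_fun (`[0%R, +oo[ : set R) phi ->
  leb.-integrable `[0, b] (EFin \o (fun y => phi y ^+ 2)) -> continuous P ->
  leb.-integrable `[0, b] (EFin \o (fun y => (phi y - P y) ^+ 2)).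
Proof.
move=> b0 mphi iphi cP.
have iP : leb.-integrable `[0, b] (EFin \o (fun y => 2 * P y ^+ 2)).
  apply: continuous_integrable_itv => y; apply: cvgM; first exact: cvg_cst.
  by rewrite expr2; apply: cvgM; exact: cP.
apply: (integrable_dominated _ _ (fun y => 2 * phi y ^+ 2 + 2 * P y ^+ 2)) => //.
- apply: measurable_funX; apply: measurable_funB.
    exact: measurable_fun_itv_bnd mphi.
  exact: continuous_measurable_itv.
- by apply: EFin_integrableD => //; exact: EFin_integrableZ.
- move=> y _; rewrite ger0_norm ?sqr_ge0//.
  rewrite -subr_ge0 (_ : _ - _ = (phi y + P y) ^+ 2) ?sqr_ge0//; ring.
Qed.

(** With [X = e^Y] in the explicit formula, [phi - P] on [[y0, Y]] is a tail of the sum plus the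
    error term, and both have small mean square. *)
Lemma power_growth_B2 (phi : R -> R) (y0 : R)
  (lam : nat -> R) (r : nat -> R[i]) (c X0 : R) (E : R -> R -> R) (C a b : R) (k1 : nat) :
  0 <= y0 ->
  measurable_fun (`[0%R, +oo[ : set R) phi ->
  leb.-integrable `[0%R, y0] (fun y => ((phi y) ^+ 2)%:E) ->
  (forall n, 0 < lam n) -> lam @ \oo --> +oo ->
  (forall y X, y0 <= y -> X0 <= X -> phi y = c + trunc_sum lam r X y + E y X) ->
  ((Y^-1)%:E * \int[leb]_(y in `[y0, Y])
        ((E y (expR Y)) ^+ 2)%:E)%E @[Y --> +oo] --> 0%E ->
  0 < C -> 0 < b -> a < 2 * b -> (0 < k1)%N -> power_growth lam r C a b k1 ->
  B2_almost_periodic phi.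
Proof.
move=> y00 mphi iphi lam0 lamy hphi hE C0 b0 ab k10 pg eps eps0.
have [q hq] : {q : nat -> nat & forall n, (q n)%:R < lam n <= (q n).+1%:R}.
  by apply: (choice (P := fun n k => k%:R < lam n <= k.+1%:R)) => n; exact: exists_unit_block.
have [theta htheta] : {theta : nat -> R & forall n, forall x,
    complex.Re (r n * expi x) = Normc.normc (r n) * cos (x + theta n)}.
  apply: (choice (P := fun n t => forall x, complex.Re (r n * expi x) = Normc.normc (r n) * cos (x + t))).
  by move=> n; exact: polar_form.
pose rho n := Normc.normc (r n).
have rho0 n : 0 <= rho n by rewrite /rho; case: (r n) => x y; exact: sqrtr_ge0.
(* Chosen so that the tail contributes [2 * 12 * eta = eps^2 / 8]; the error term and the interval
   [[0, y0]] contribute at most [eps^2 / 8] each, within [eps^2 / 2]. *)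
pose eta := eps ^+ 2 / 192; have eps20 : 0 < eps ^+ 2 by rewrite exprn_gt0.
have eta0 : 0 < eta by rewrite divr_gt0.
have [k0 k1k0 hk0] := power_growth_tail lam r q C a b k1 eta lamy hq C0 b0 ab k10 pg eta0.
have [N0 hN0] := cvgy_bounded_index lam k0%:R lamy.
pose P y := c + \sum_(0 <= n < N0 | lam n <= k0%:R) rho n * cos (lam n * y + theta n).
have tP : trigp P.
  apply: trigpD; first exact: trigp_cst.
  by apply: trigp_sum => n; exact: trigp_cos.
have cP := trigp_continuous _ tP.
have [N [aa [mu hP]]] := trigp_trig_poly _ tP.
exists N, aa, mu; split=> [y|]; first by rewrite hP.
have hRe y : complex.Re (trig_poly N aa mu y) = P y by rewrite hP.
have i0 := sqr_integrable_sub_continuous phi P y0 y00 mphi iphi cP.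
pose K0 := \int[leb]_(y in `[0, y0]) ((phi y - P y) ^+ 2).
have K00 : 0 <= K0 by apply: Rintegral_ge0 => y _; exact: sqr_ge0.
apply: (@le_lt_trans _ _ (eps ^+ 2 / 2)%:E); last by rewrite lte_fin; lra.
apply: limf_esup_le.
have hE' : \forall Y \near +oo, ((Y^-1)%:E * \int[leb]_(y in `[y0, Y])
        ((E y (expR Y)) ^+ 2)%:E < (eps ^+ 2 / 16)%:E)%E.
  apply: (hE [set x | (x < (eps ^+ 2 / 16)%:E)%E]).
  by apply: open_ereal_lt'; rewrite lte_fin divr_gt0.
near=> Y.
have Y1 : 1 <= Y by near: Y; apply: nbhs_pinfty_ge; exact: num_real.
have Y0 : 0 < Y by lra.
have y0Y : y0 <= Y by near: Y; apply: nbhs_pinfty_ge; exact: num_real.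
have YK : K0 * 8 / eps ^+ 2 <= Y by near: Y; apply: nbhs_pinfty_ge; exact: num_real.
have YX : X0 <= Y by near: Y; apply: nbhs_pinfty_ge; exact: num_real.
have Yk : k0%:R <= Y by near: Y; apply: nbhs_pinfty_ge; exact: num_real.
have EY : ((Y^-1)%:E * \int[leb]_(y in `[y0, Y])
        ((E y (expR Y)) ^+ 2)%:E < (eps ^+ 2 / 16)%:E)%E by near: Y.
(* Hence [e^Y] exceeds [X0] and [k0]: the formula applies and the truncated sum contains all terms
   of [P]. *)
have YeY : Y <= expR Y by apply: le_trans (expR_ge1Dx _); lra.
have [NY hNY] := cvgy_bounded_index lam (expR Y) lamy.
pose s := [seq n <- index_iota 0 NY | (k0 <= q n)%N && (lam n <= expR Y)].
have us : uniq s by rewrite filter_uniq// iota_uniq.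
pose G y := \sum_(n <- s) rho n * cos (lam n * y + theta n).
have cG : continuous G.
  apply: continuous_sum => n y; apply: cvgM; first exact: cvg_cst.
  exact: continuous_cos_affine.
(* The cut falls at the integer [k0], so it never splits a left-open unit block. *)
have k0q n : (k0 <= q n)%N = ~~ (lam n <= k0%:R).
  have /andP[h1 h2] := hq n; rewrite -ltNge; apply/idP/idP => [k0n|h].
    by rewrite (le_lt_trans _ h1)// ler_nat.
  by have := lt_le_trans h h2; rewrite ltr_nat.
have split_sum y : trunc_sum lam r (expR Y) y =
    \sum_(0 <= n < N0 | lam n <= k0%:R) rho n * cos (lam n * y + theta n) + G y.
  rewrite -(trunc_sum_cos _ _ _ r _ _ _ htheta hN0).
  rewrite (trunc_sum_cos _ rho theta r k0%:R y NY htheta); last first.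
    by move=> n h; apply: hNY; rewrite (le_trans h)// (le_trans Yk).
  rewrite (trunc_sum_cos _ _ _ r _ _ _ htheta hNY) (bigID (fun n => lam n <= k0%:R))/=.
  congr (_ + _).
    apply: eq_bigl => n; apply/andb_idl => h; by rewrite (le_trans h)// (le_trans Yk).
  by rewrite /G big_filter; apply: eq_bigl => n; rewrite k0q andbC.
have phiE y : y0 <= y -> E y (expR Y) = phi y - P y - G y.
  move=> yy; have := hphi y (expR Y) yy (le_trans YX YeY).
  by rewrite split_sum => ->; rewrite /P; ring.
have mD : measurable_fun (`[0%R, Y] : set (measurableTypeR R)) (fun y => phi y - P y).
  apply: measurable_funB; first exact: measurable_fun_itv_bnd mphi.
  exact: continuous_measurable_itv.
have mD' : measurable_fun (`[y0, Y] : set (measurableTypeR R)) (fun y => phi y - P y - G y).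
  apply: measurable_funB; last exact: continuous_measurable_itv.
  by apply: measurable_funS mD => //; apply: subset_itvr; rewrite bnd_simp.
have IE : (\int[leb]_(y in `[y0, Y]) ((phi y - P y - G y) ^+ 2)%:E <= (Y * (eps ^+ 2 / 16))%:E)%E.
  move/ltW: EY; rewrite lee_pdivrMl// -EFinM; apply: le_trans.
  rewrite le_eqVlt; apply/orP; left; apply/eqP; apply: eq_integral => y.
  by rewrite inE/= in_itv/= => /andP[yy _]; rewrite phiE.
have iE : leb.-integrable `[y0, Y] (EFin \o (fun y => (phi y - P y - G y) ^+ 2)).
  by apply: integrable_sqr_lty => //; rewrite (le_lt_trans IE)// ltry.
have IE' : \int[leb]_(y in `[y0, Y]) ((phi y - P y - G y) ^+ 2) <= Y * (eps ^+ 2 / 16).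
  rewrite -lee_fin (le_trans _ IE)//.
  by rewrite /Rintegral fineK//; exact: integrable_fin_num iE.
have IG : \int[leb]_(y in `[y0, Y]) (G y ^+ 2) <= 12 * Y * eta.
  apply: (mean_square_block_le lam rho theta q (fun k => C * k%:R `^ (- b)) k0) => //.
  - by move=> i; rewrite mem_filter => /andP[/andP[]].
  - by move=> i; rewrite mem_filter => /andP[/andP[]].
  - move=> k kk; apply: (le_trans _ (pg.1 k (leq_trans k1k0 kk))).
    apply: (le_trans _ (sum_le_abs_sum lam r _ _ s lamy us)).
    rewrite big_mkcond [leRHS]big_mkcond; apply: ler_sum => n _.
    case: eqP => [<-|_]; last by case: ifP => // _; exact: rho0.
    by rewrite natr1 hq.
  - move=> k l kk kl; rewrite ler_pM2l// !powRN.
    have k0R : (0 < k)%N by rewrite (leq_trans k10)// (leq_trans k1k0).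
    rewrite lef_pV2 ?posrE ?powR_gt0 ?ltr0n//; last by rewrite (leq_trans k0R).
    by apply: ge0_ler_powR; rewrite ?nnegrE ?ler0n ?ler_nat// ltW.
  - rewrite (le_trans _ (hk0 s us))// le_eqVlt; apply/orP; left; apply/eqP.
    rewrite [RHS]big_mkcond [LHS]big_seq [RHS]big_seq; apply: eq_bigr => n.
    by rewrite mem_filter => /andP[/andP[-> _] _].
have iG : leb.-integrable `[y0, Y] (EFin \o (fun y => G y ^+ 2)).
  by apply: continuous_integrable_itv => y; exact: (cvgM (cG y) (cG y)).
pose H y := 2 * G y ^+ 2 + 2 * (phi y - P y - G y) ^+ 2.
have iH : leb.-integrable `[y0, Y] (EFin \o H).
  by apply: EFin_integrableD => //; exact: EFin_integrableZ.
have HH y : (phi y - P y) ^+ 2 <= H y.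
  rewrite /H; move: (phi y - P y) (G y) => u v.
  rewrite -subr_ge0 (_ : _ - _ = (u - 2 * v) ^+ 2) ?sqr_ge0//; ring.
have I2 : (\int[leb]_(y in `[y0, Y]) ((phi y - P y) ^+ 2)%:E <=
    (2 * (12 * Y * eta) + 2 * (Y * (eps ^+ 2 / 16)))%:E)%E.
  apply: (@le_trans _ _ (\int[leb]_(y in `[y0, Y]) (H y)%:E)%E).
    apply: ge0_le_integral => //.
    - by move=> y _; rewrite lee_fin sqr_ge0.
    - apply/measurable_EFinP; apply: measurable_funX.
      by apply: measurable_funS mD => //; apply: subset_itvr; rewrite bnd_simp.
    - exact: measurable_int iH.
    - by move=> y _; rewrite lee_fin HH.
  rewrite -[leLHS]fineK; last exact: integrable_fin_num iH.
  rewrite lee_fin -/(Rintegral leb `[y0, Y]%classic H) /H RintegralD//; last 2 first.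
    exact: EFin_integrableZ.
    exact: EFin_integrableZ.
  by rewrite !RintegralZl// lerD// ler_pM2l.
rewrite lee_pdivrMl// -EFinM.
under eq_integral do rewrite hRe.
have m2 : measurable_fun (`[0, Y] : set (measurableTypeR R)) (fun y => (phi y - P y) ^+ 2).
  exact: measurable_funX.
apply: (le_trans (ge0_integral_itv_split_le (fun y => (phi y - P y) ^+ 2) _ _ _ y00 y0Y m2 (fun=> sqr_ge0 _))).
apply: (le_trans (leeD2l _ I2)).
rewrite (_ : (\int[leb]_(y in `[0%R, y0]) ((phi y - P y) ^+ 2)%:E)%E = K0%:E); last first.
  by rewrite /K0 /Rintegral fineK//; exact: integrable_fin_num i0.
rewrite -EFinD lee_fin.
move: YK; rewrite ler_pdivrMr// /eta => YK.
by move: (eps ^+ 2) eps20 YK => z z0 YK; nra.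
Unshelve. all: end_near. Qed.

End Explicit_formula.

(** * Almost periodicity and limiting distribution under the growth hypotheses (a) or (b) *)

Theorem theorem1p2 (R : realType) (phi : R -> R) (y0 : R)
  (lam : nat -> R) (r : nat -> R[i]) (c X0 : R) (E : R -> R -> R)
  (alpha beta gamma : R) :
  0 <= y0 ->
  (* phi measurable on [0,oo) and square-integrable on [0, y0] *)
  measurable_fun (`[0%R, +oo[ : set R) phi ->
  lebesgue_measure.-integrable `[0%R, y0] (fun y => ((phi y) ^+ 2)%:E) ->
  (* (lambda_n) positive, non-decreasing, tending to infinity *)
  (forall n, 0 < lam n) -> {homo lam : m n / (m <= n)%N >-> m <= n} ->
  lam @ \oo --> +oo ->
  0 < X0 ->
  (* the explicit formula, with error term E *)
  (forall y X, y0 <= y -> X0 <= X -> phi y = c + trunc_sum lam r X y + E y X) ->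
  ((Y^-1)%:E * \int[lebesgue_measure]_(y in `[y0, Y])
        ((E y (expR Y)) ^+ 2)%:E)%E @[Y --> +oo] --> 0%E ->
  0 < alpha -> 0 < beta -> 0 <= gamma ->
  ( (* (a) *)
    (1 / 2 < beta /\
     exists M, 0 < M /\ \forall T \near +oo,
       abs_sum lam r T (T + 1) <= M * (ln T `^ gamma / T `^ beta))
  \/ (* (b) *)
    (beta <= Num.min 1 alpha /\ alpha ^+ 2 + alpha / 2 < beta ^+ 2 + beta /\
     exists M T1, 0 < M /\ forall S T, T1 <= S -> S < T ->
       abs_sum lam r S T <= M * ((T - S) `^ alpha * ln T `^ gamma / S `^ beta))) ->
  B2_almost_periodic phi /\ has_limiting_distribution phi.
Proof.
move=> y00 mphi iphi lam0 _ lamy _ hphi hE a0 b0 g0 hab.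
suff B2 : B2_almost_periodic phi by split=> //; exact: B2_limiting_distribution.
have [C [a [b [k1 [C0 b0' ab k10 pg]]]]] :
    exists C a b k1, [/\ 0 < C, 0 < b, a < 2 * b, (0 < k1)%N & power_growth lam r C a b k1].
  case: hab => [[b2 [M [M0 hM]]]|[_ [ab [M [T1 [M0 hM]]]]]].
    exact: power_growth_unit_blocks hM.
  exact: power_growth_all_blocks hM.
exact: (power_growth_B2 phi y0 lam r c X0 E C a b k1).
Qed.
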